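(* Assume (A1), (A2), (A4). Then for every $\lambda\in S^1$, the map $G(\lambda,\cdot):\ell^2\to\ell^2$, $\mathbf x\mapsto S\mathbf x-(f_n(\lambda,x_n))_n$, is proper on closed bounded subsets of $\ell^2$.
   Context: $\ell^2$ is the Hilbert space of $\mathbb R^d$-valued sequences on $\mathbb Z$ with $\sum|x_n|^2<\infty$; $S\mathbf x=(x_{n+1})$. $f_n:S^1\times\mathbb R^d\to\mathbb R^d$ are $C^1$ with $f_n(\lambda,0)=0$. Proper on closed bounded subsets: the restriction to every closed bounded set has compact preimages of compact sets. (A1) For any $M>0,\varepsilon>0$ there is $\delta\in(0,M)$ with $\sup_n|\partial_x f_n(\lambda_1,x_1)-\partial_x f_n(\lambda_2,x_2)|<\varepsilon$ and $\sup_n|\partial_\lambda f_n(\lambda_1,x_1)-\partial_\lambda f_n(\lambda_2,x_2)|<\varepsilon$ whenever $(\lambda_i,x_i)\in S^1\times\bar B_d(0,M)$ are at distance $<\delta$ ($\partial_\lambda$ in the angle coordinate). (A2) $\partial_x f_n(\lambda,0)\to a(\lambda,\pm\infty)$ as $n\to\pm\infty$ uniformly in $\lambda$, with $a(\lambda,\pm\infty)$ hyperbolic (invertible, no eigenvalue of modulus one) and having the same number of eigenvalues in the open unit disk. (A4) $f_n(\lambda,x)\to f^\infty_\pm(\lambda,x)$ as $n\to\pm\infty$ uniformly for $x$ in bounded subsets of $\mathbb R^d$, and for each $\lambda\in S^1$ the equations $x_{n+1}=f^\infty_+(\lambda,x_n)$ and $x_{n+1}=f^\infty_-(\lambda,x_n)$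 have no nonzero solution $(x_n)\in\ell^2$. *)

(* Defs.v *)
From Stdlib Require Import Reals List ZArith.
From mathcomp Require Import all_boot.
Open Scope R_scope.

Definition Rd (d : nat) := 'I_d -> R.
Definition Mat (d : nat) := 'I_d -> 'I_d -> R.

Definition rsum {d : nat} (F : 'I_d -> R) : R := \big[Rplus/R0]_(i < d) F i.

Definition vzero (d : nat) : Rd d := fun _ => 0.
Definition vadd {d} (v w : Rd d) : Rd d := fun i => v i + w i.
Definition vsub {d} (v w : Rd d) : Rd d := fun i => v i - w i.
Definition vnorm {d} (v : Rd d) : R := sqrt (rsum (fun i => v i * v i)).
Definition msub {d} (A B : Mat d) : Mat d := fun i j => A i j - B i j.
Definition mnorm {d} (A : Mat d) : R :=
  sqrt (rsum (fun i => rsum (fun j => A i j * A i j))).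
Definition mv {d} (A : Mat d) (v : Rd d) : Rd d := fun i => rsum (fun j => A i j * v j).
Definition mmul {d} (A B : Mat d) : Mat d := fun i k => rsum (fun j => A i j * B j k).
Definition mid (d : nat) : Mat d := fun i j => if i == j then 1 else 0.

(* ---------- C^1 maps on S^1 x R^d ----------
   lambda in S^1 is represented by its angle th in R; the map is 2*PI-periodic
   in th.  Dl = d/dth f (angle coordinate), Dx = d_x f (Jacobian matrix);
   f is (Frechet) differentiable with these partial derivatives, jointly
   continuous. *)
Definition is_C1_S1 {d} (f : R -> Rd d -> Rd d) (Dl : R -> Rd d -> Rd d)
  (Dx : R -> Rd d -> Mat d) : Prop :=
  (forall th x, f (th + 2 * PI) x = f th x) /\
  (forall th x eps, 0 < eps -> exists del, 0 < del /\
     forall h k, Rabs h + vnorm k < del ->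
       vnorm (fun i => f (th + h) (vadd x k) i - f th x i - h * Dl th x i
                       - mv (Dx th x) k i) <= eps * (Rabs h + vnorm k)) /\
  (forall th x eps, 0 < eps -> exists del, 0 < del /\
     forall th' x', Rabs (th' - th) + vnorm (vsub x' x) < del ->
       vnorm (vsub (Dl th' x') (Dl th x)) < eps /\
       mnorm (msub (Dx th' x') (Dx th x)) < eps).

Definition sup_lt (g : Z -> R) (eps : R) : Prop :=
  exists eta, eta < eps /\ forall n, g n <= eta.

Definition C := (R * R)%type.
Definition C0 : C := (0, 0).
Definition Cadd (z w : C) : C := (fst z + fst w, snd z + snd w).
Definition Cmul (z w : C) : C :=
  (fst z * fst w - snd z * snd w, fst z * snd w + snd z * fst w).
Definition Cmod (z : C) : R := sqrt (fst z * fst z + snd z * snd z).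

Definition cvec (d : nat) := 'I_d -> C.

Definition shift_apply {d} (A : Mat d) (mu : C) (v : cvec d) : cvec d :=
  fun i => (rsum (fun j => A i j * fst (v j)) - fst (Cmul mu (v i)),
            rsum (fun j => A i j * snd (v j)) - snd (Cmul mu (v i))).

Definition is_eigenvalue {d} (A : Mat d) (mu : C) : Prop :=
  exists v : cvec d, (exists i, v i <> C0) /\ forall i, shift_apply A mu v i = C0.

Definition gen_eig {d} (A : Mat d) (mu : C) (v : cvec d) : Prop :=
  forall i, Nat.iter d (shift_apply A mu) v i = C0.

Definition lincomb {d} (cs : list C) (bs : list (cvec d)) : cvec d :=
  fold_right (fun p acc => fun i => Cadd (Cmul (fst p) (snd p i)) (acc i))
             (fun _ => C0) (combine cs bs).

Definition lin_indep {d} (bs : list (cvec d)) : Prop :=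
  forall cs, length cs = length bs -> (forall i, lincomb cs bs i = C0) ->
    Forall (fun c => c = C0) cs.

Definition cdim {d} (V : cvec d -> Prop) (k : nat) : Prop :=
  exists bs, length bs = k /\ Forall V bs /\ lin_indep bs /\
    forall v, V v -> exists cs, length cs = length bs /\ forall i, v i = lincomb cs bs i.

Definition eig_count_disk {d} (A : Mat d) (N : nat) : Prop :=
  exists l : list C, NoDup l /\
    (forall mu, In mu l <-> (is_eigenvalue A mu /\ Cmod mu < 1)) /\
    exists ks : list nat, Forall2 (fun mu k => cdim (gen_eig A mu) k) l ks /\
      N = list_sum ks.

Definition hyperbolic {d} (A : Mat d) : Prop :=
  (exists B : Mat d, forall i j, mmul A B i j = mid d i j /\ mmul B A i j = mid d i j) /\
  (forall mu, is_eigenvalue A mu -> Cmod mu <> 1).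

Definition Seq (d : nat) := Z -> Rd d.

Definition psum {d} (x : Seq d) (N : nat) : R :=
  sum_f_R0 (fun k => let v := x (Z.of_nat k - Z.of_nat N)%Z in rsum (fun i => v i * v i))
           (2 * N).

Definition dist_le {d} (x y : Seq d) (r : R) : Prop :=
  0 <= r /\ forall N, psum (fun n => vsub (x n) (y n)) N <= r * r.
Definition dist_lt {d} (x y : Seq d) (r : R) : Prop :=
  exists r', r' < r /\ dist_le x y r'.

Definition in_l2 {d} (x : Seq d) : Prop := exists r, dist_le x (fun _ => vzero d) r.

Definition open_l2 {d} (U : Seq d -> Prop) : Prop :=
  forall x, in_l2 x -> U x -> exists r, 0 < r /\
    forall y, in_l2 y -> dist_lt x y r -> U y.
Definition closed_l2 {d} (Cs : Seq d -> Prop) : Prop :=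
  (forall x, Cs x -> in_l2 x) /\
  forall x, in_l2 x -> (forall r, 0 < r -> exists y, Cs y /\ dist_lt x y r) -> Cs x.
Definition bounded_l2 {d} (Cs : Seq d -> Prop) : Prop :=
  exists r, forall x, Cs x -> dist_le x (fun _ => vzero d) r.
Definition compact_l2 {d} (K : Seq d -> Prop) : Prop :=
  (forall x, K x -> in_l2 x) /\
  forall (I : Type) (U : I -> Seq d -> Prop), (forall i, open_l2 (U i)) ->
    (forall x, K x -> exists i, U i x) ->
    exists l : list I, forall x, K x -> exists i, In i l /\ U i x.

Definition proper_cb {d} (F : Seq d -> Seq d) : Prop :=
  forall Cs, closed_l2 Cs -> bounded_l2 Cs ->
  forall K, compact_l2 K -> compact_l2 (fun x => Cs x /\ K (F x)).

Definition Gmap {d} (f : Z -> R -> Rd d -> Rd d) (th : R) (x : Seq d) : Seq d :=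
  fun n => vsub (x (n + 1)%Z) (f n th (x n)).

(* Main.v *)
Require Import Defs.
From Stdlib Require Import Reals List ZArith.
From Stdlib Require Import Lra Lia Classical ClassicalEpsilon FunctionalExtensionality.
From mathcomp Require Import all_boot.
From mathcomp Require all_algebra complex Rstruct boolp classical_sets filter.
Open Scope R_scope.

(** Let [x_k] be a bounded sequence whose images [G x_k] stay in a compact set. A nonprincipal
    ultrafilter on [nat] replaces the successive extractions of subsequences: along it [G x_k]
    converges in l^2 and [x_k] converges coordinatewise, to [x] say. If [|x_k(n)|] were not
    uniformly small for large [|n|], translates of the [x_k] would converge to a nonzero l^2 solution
    of one of the limit equations, which (A4) excludes. So far out both [x_k] and [x] live near [0],
    where [x_k - x] solves a small perturbation of the recurrence [w(n+1) = a w(n) + h(n)] with [a]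
    hyperbolic. On an interval of any length the l^2 norm of a solution is controlled by [h] and
    the two end values: the product of the factors [a - mu] over the eigenvalues [mu] vanishes by
    Cayley-Hamilton, so it suffices to treat scalar recurrences with [|mu| <> 1]. Hence [x_k]
    converges to [x] in norm. *)

(** * An annihilating product over the eigenvalues *)

(** Coordinatewise convergence settles every finite window, so the difficulty is the energy that may
    sit in the tails. The estimate there needs no stable and unstable subspaces: a scalar recurrence
    is summed forward when |mu| < 1 and backward when |mu| > 1, and keeping both end values lets one
    inequality cover both cases. Its constant depends on [a] alone and not on the length of the
    interval. This is what makes the limit work: the inner end value tends to [0] along the
    ultrafilter, while the outer end can be pushed out, to a place depending on [k], where the l^2
    sequence x_k - x is already small. Norms enter the estimates squared, so Young's inequality
    takes over from the triangle inequality. *)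

Module Annihilation.
Import all_algebra complex Rstruct.
Import GRing.Theory.
Local Open Scope ring_scope.

Definition cplx (z : Defs.C) : R[i] := Complex z.1 z.2.

Lemma cplx_inj : injective cplx.
Proof. by move=> [a b] [c e] [-> ->]. Qed.

Definition row_of {d} (v : cvec d) : 'rV[R[i]]_d := \row_i cplx (v i).
(** Transposed, because matrices act here on row vectors from the right: [row_of v *m mx_of A] is
    then the row of the column product [A v]. *)
Definition mx_of {d} (A : Mat d) : 'M[R[i]]_d := \matrix_(j, i) (A i j)%:C%C.

Lemma complex_sumE (n : nat) (F : 'I_n -> R[i]) :
  \sum_(i < n) F i = Complex (rsum (fun i => complex.Re (F i))) (rsum (fun i => complex.Im (F i))).
Proof.
rewrite /rsum; elim/big_rec3: _ => [//|i x y z _ ->].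
by case: (F i) => a b.
Qed.

Lemma row_shift_apply {d} (A : Mat d) (mu : Defs.C) (v : cvec d) :
  row_of (shift_apply A mu v) = row_of v *m mx_of A - cplx mu *: row_of v.
Proof.
apply/rowP => i; rewrite !mxE complex_sumE /shift_apply /Cmul /cplx /=.
congr Complex; congr (_ - _); apply: eq_bigr => j _; by rewrite !mxE /= mulr0 ?subr0 ?add0r mulrC.
Qed.

(** The list consists of the roots of the characteristic polynomial with multiplicity, so the fold
    evaluates that polynomial at [A] and Cayley-Hamilton applies. *)
Lemma annihilating_eigenvalues {d} (A : Mat d) : exists s : list Defs.C,
  (forall mu, List.In mu s -> is_eigenvalue A mu) /\
  forall v i, fold_right (fun mu u => shift_apply A mu u) v s i = C0.
Proof.
case: d A => [|d] A; first by exists nil; split => // v [].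
have [r Hr] := closed_field_poly_normal (char_poly (mx_of A)).
rewrite (eqP (char_poly_monic _)) scale1r in Hr.
exists (List.map (fun z : R[i] => (complex.Re z, complex.Im z)) r); split.
- move=> mu /List.in_map_iff [z [<- zr]].
  have zr' : z \in r.
    elim: r zr {Hr} => //= y r IH [->|/IH]; rewrite inE ?eqxx // => ->; exact: orbT.
  have : eigenvalue (mx_of A) z by rewrite eigenvalue_root_char Hr root_prod_XsubC.
  case/eigenvalueP => v Hv v0.
  pose u : cvec d.+1 := fun i => (complex.Re (v ord0 i), complex.Im (v ord0 i)).
  have uE : row_of u = v.
    by apply/rowP => i; rewrite !mxE /cplx /u /=; case: (v _ _).
  exists u; split.
  + have [i Hi] : exists i, v ord0 i != 0.
      by apply/rV0Pn.
    exists i => Hu; move: Hi; rewrite -uE mxE Hu; by rewrite eqxx.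
  + move=> i; apply: cplx_inj.
    have := row_shift_apply A (complex.Re z, complex.Im z) u.
    rewrite uE Hv => /rowP /(_ i); rewrite !mxE => ->.
    by rewrite /cplx /=; case: (z) => a b /=; rewrite subrr.
- move=> v i; apply: cplx_inj.
  have H : row_of (fold_right (fun mu u => shift_apply A mu u) v
       (List.map (fun z : R[i] => (complex.Re z, complex.Im z)) r)) =
       row_of v *m horner_mx (mx_of A) (\prod_(z <- r) ('X - z%:P)).
    elim: r {Hr} => [|z r IH] /=.
      by rewrite big_nil rmorph1 mulmx1.
    (* The head of the list acts last in the fold, hence stands rightmost in the row action;
       commutativity of polynomials moves its factor there. *)
    rewrite row_shift_apply IH big_cons mulrC rmorphM /= -mulmxE mulmxA.
    rewrite rmorphB /= horner_mx_X horner_mx_C mulmxBr mul_mx_scalar.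
    by congr (_ - _ *: _); case: (z).
  move: H; rewrite -Hr Cayley_Hamilton mulmx0 => /rowP /(_ i).
  by rewrite !mxE => ->.
Qed.

End Annihilation.

(** * Finite sums and squared norms *)

Lemma eq_rsum {n} (F G : 'I_n -> R) : (forall i, F i = G i) -> rsum F = rsum G.
Proof. by move=> H; apply: eq_bigr => i _. Qed.

Section RplusMonoid.
Import Rstruct.
Local Open Scope R_scope.

Lemma rsum_add {n} (F G : 'I_n -> R) : rsum (fun i => F i + G i) = rsum F + rsum G.
Proof. exact: big_split. Qed.

Lemma rsum_recr (L : nat) (g : nat -> R) :
  @rsum L.+1 (fun j => g j) = @rsum L (fun j => g j) + g L.
Proof. exact: big_ord_recr. Qed.

Lemma rsum_recl (L : nat) (g : nat -> R) :
  @rsum L.+1 (fun j => g j) = g 0%N + @rsum L (fun j => g (S j)).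
Proof. exact: big_ord_recl. Qed.

Lemma rsum_D1 {n} (F : 'I_n -> R) i :
  rsum F = F i + \big[Rplus/0]_(j < n | j != i) F j.
Proof. exact: bigD1. Qed.

End RplusMonoid.

Lemma rsum_scal {n} (c : R) (F : 'I_n -> R) : rsum (fun i => c * F i) = c * rsum F.
Proof.
rewrite /rsum; elim/big_rec2: _ => [|i x y _ ->]; lra.
Qed.

Lemma rsum_sub {n} (F G : 'I_n -> R) : rsum (fun i => F i - G i) = rsum F - rsum G.
Proof.
have -> : rsum F - rsum G = rsum F + (-1) * rsum G by lra.
by rewrite -rsum_scal -rsum_add; apply: eq_rsum => i; lra.
Qed.

Lemma rsum_le {n} (F G : 'I_n -> R) : (forall i, F i <= G i) -> rsum F <= rsum G.
Proof.
move=> H; rewrite /rsum; elim/big_rec2: _ => [|i x y _ ?]; first lra.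
have := H i; lra.
Qed.

Lemma rsum_const n (c : R) : rsum (fun _ : 'I_n => c) = INR n * c.
Proof.
rewrite /rsum big_const_ord; elim: n => [|n IH]; rewrite ?iterS ?S_INR /=; first lra.
rewrite IH; lra.
Qed.

Lemma rsum_ge0 {n} (F : 'I_n -> R) : (forall i, 0 <= F i) -> 0 <= rsum F.
Proof.
move=> H; have := rsum_le (fun _ => 0) F H; rewrite rsum_const; lra.
Qed.

Lemma rsum_le_const {n} (F : 'I_n -> R) (c : R) : (forall i, F i <= c) -> rsum F <= INR n * c.
Proof. by move=> H; rewrite -rsum_const; apply: rsum_le. Qed.

Lemma rsum_term_le {n} (F : 'I_n -> R) i : (forall i, 0 <= F i) -> F i <= rsum F.
Proof.
move=> H; rewrite (rsum_D1 F i).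
suff : 0 <= \big[Rplus/0]_(j < n | j != i) F j by lra.
elim/big_rec: _ => [|j x _ ?]; first lra.
have := H j; lra.
Qed.

Lemma rsum0 (F : 'I_0 -> R) : rsum F = 0.
Proof. exact: big_ord0. Qed.

Lemma rsum_rev (L : nat) (g : nat -> R) :
  @rsum L (fun j => g (L - S j)%coq_nat) = @rsum L (fun j => g j).
Proof.
elim: L => [|L IH]; first by rewrite !rsum0.
rewrite (rsum_recl L (fun j => g (S L - S j)%coq_nat)) rsum_recr -IH Nat.sub_succ Nat.sub_0_r.
by rewrite Rplus_comm.
Qed.

Lemma rsum_mono (L L' : nat) (g : nat -> R) : (forall j, 0 <= g j) -> (L <= L')%coq_nat ->
  @rsum L (fun j => g j) <= @rsum L' (fun j => g j).
Proof.
move=> H; elim => [|m _ IH]; first lra.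
rewrite rsum_recr; have := H m; lra.
Qed.

Lemma cauchy_schwarz {n} (a b : 'I_n -> R) :
  rsum (fun i => a i * b i) * rsum (fun i => a i * b i) <=
  rsum (fun i => a i * a i) * rsum (fun i => b i * b i).
Proof.
set p := rsum (fun i => a i * b i); set A := rsum (fun i => a i * a i).
set B := rsum (fun i => b i * b i).
have H (s t : R) : 0 <= s * s * A - 2 * (s * t) * p + t * t * B.
  have -> : s * s * A - 2 * (s * t) * p + t * t * B =
     rsum (fun i => (s * a i - t * b i) * (s * a i - t * b i)).
    rewrite /A /B /p -!rsum_scal -rsum_sub -rsum_add; apply: eq_rsum => i; ring.
  by apply: rsum_ge0 => i; exact: Rle_0_sqr.
have A0 : 0 <= A by apply: rsum_ge0 => i; exact: Rle_0_sqr.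
have B0 : 0 <= B by apply: rsum_ge0 => i; exact: Rle_0_sqr.
(* At [(p, A)] the form equals [A (A B - p^2)], which settles [A > 0]; for [A = 0] the other
   instances force [p = 0]. *)
have := H B p; have := H p A; have := H 1 p; have := H p 1.
case: (Rle_lt_or_eq_dec 0 A A0) => [A1|A1]; first by nra.
rewrite -A1; nra.
Qed.

Definition nsq {d} (v : Rd d) : R := rsum (fun i => v i * v i).

Lemma nsq_ge0 {d} (v : Rd d) : 0 <= nsq v.
Proof. by apply: rsum_ge0 => i; exact: Rle_0_sqr. Qed.

Lemma eq_nsq {d} (v w : Rd d) : (forall i, v i = w i) -> nsq v = nsq w.
Proof. by move=> H; apply: eq_rsum => i; rewrite H. Qed.

Lemma nsq_scal {d} (c : R) (v : Rd d) : nsq (fun i => c * v i) = c * c * nsq v.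
Proof. rewrite /nsq -rsum_scal; apply: eq_rsum => i; ring. Qed.

Lemma nsq_zero d : nsq (vzero d) = 0.
Proof. rewrite /nsq /vzero rsum_const; lra. Qed.

Lemma nsq_coord {d} (v : Rd d) i : v i * v i <= nsq v.
Proof. by apply: (rsum_term_le (fun i => v i * v i)) => j; exact: Rle_0_sqr. Qed.

Lemma nsq_coord_abs {d} (v : Rd d) i b : 0 <= b -> nsq v <= b * b -> Rabs (v i) <= b.
Proof.
move=> b0 H; have := nsq_coord v i; move=> Hi.
apply: Rabs_le; nra.
Qed.

(* Young's inequality, [2 u v <= t u^2 + v^2 / t]. *)
Lemma young_sq (t u v : R) : 0 < t ->
  (u + v) * (u + v) <= (1 + t) * (u * u) + (1 + / t) * (v * v).
Proof.
move=> t0; have := Rinv_0_lt_compat _ t0; move=> ti.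
have E : t * / t = 1 by apply: Rinv_r; lra.
have : 0 <= / t * ((t * u - v) * (t * u - v)).
  by apply: Rmult_le_pos; [lra|exact: Rle_0_sqr].
have -> : / t * ((t * u - v) * (t * u - v)) = (t * / t) * t * (u * u) - 2 * (t * / t) * u * v + / t * (v * v) by ring.
rewrite E; nra.
Qed.


Lemma nsq_young {d} (t : R) (u v w : Rd d) : 0 < t -> (forall i, w i = u i + v i) ->
  nsq w <= (1 + t) * nsq u + (1 + / t) * nsq v.
Proof.
move=> t0 H; rewrite /nsq -!rsum_scal -rsum_add; apply: rsum_le => i.
rewrite H; exact: young_sq.
Qed.

Lemma nsq_add_le {d} (u v w : Rd d) : (forall i, w i = u i + v i) ->
  nsq w <= 2 * nsq u + 2 * nsq v.
Proof. move=> H; have := nsq_young 1 u v w Rlt_0_1 H; lra. Qed.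

Lemma vnorm_lt_nsq {d} (v : Rd d) b : vnorm v < b -> nsq v < b * b.
Proof.
rewrite -[vnorm v]/(sqrt (nsq v)) => H; have := sqrt_pos (nsq v); have := sqrt_sqrt _ (nsq_ge0 v); nra.
Qed.

Lemma nsq_le_vnorm {d} (v : Rd d) b : 0 <= b -> nsq v <= b * b -> vnorm v <= b.
Proof.
rewrite -[vnorm v]/(sqrt (nsq v)) => b0 H.
by rewrite -(sqrt_square b) //; apply: sqrt_le_1_alt.
Qed.

Lemma mnorm_lt_coord {d} (A B : Mat d) b : mnorm (msub A B) < b ->
  forall i j, Rabs (A i j - B i j) <= b.
Proof.
rewrite /mnorm; set S := rsum _ => H i j.
have S0 : 0 <= S by apply: rsum_ge0 => k; apply: rsum_ge0 => l; exact: Rle_0_sqr.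
have b0 : 0 <= b by have := sqrt_pos S; lra.
have H1 : S < b * b by have := sqrt_pos S; have := sqrt_sqrt _ S0; nra.
have H2 : rsum (fun j => msub A B i j * msub A B i j) <= S.
  apply: (rsum_term_le (fun i => rsum (fun j => msub A B i j * msub A B i j))) => k.
  by apply: rsum_ge0 => l; exact: Rle_0_sqr.
apply: (nsq_coord_abs (msub A B i)) => //; rewrite /nsq; lra.
Qed.

(* [m] is the squared modulus of an eigenvalue, [a] and [e] the squared norms of a solution
   and of its forcing term. *)
Lemma scalar_energy_estimate (m : R) : 0 <= m -> m <> 1 ->
  exists K, 0 < K /\ forall (L : nat) (a e : nat -> R),
    (forall n, 0 <= a n) -> (forall n, 0 <= e n) ->
    (forall n t, 0 < t -> a (S n) <= (1 + t) * (m * a n) + (1 + / t) * e n) ->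
    (forall n t, 0 < t -> m * a n <= (1 + t) * a (S n) + (1 + / t) * e n) ->
    @rsum L (fun n => a n) <= K * (@rsum L (fun n => e n) + a 0%N + a L).
Proof.
move=> m0 m1.
case: (Rlt_le_dec m 1) => [lt1|ge1].
(* With [m = 1 - 2 t] one has [(1 + t) m <= 1 - t], so each forward step loses at least [t a n] and
   the inequalities telescope. *)
- set t := (1 - m) / 2; have t0 : 0 < t by rewrite /t; lra.
  have D1 : 0 < 1 + / t by have := Rinv_0_lt_compat _ t0; lra.
  set D := 1 + / t in D1.
  exists (D / t + / t); split.
    have := Rinv_0_lt_compat _ t0 => ?.
    have : 0 < D / t by apply: Rdiv_lt_0_compat.
    lra.
  move=> L a e a0 e0 H _.
  have HL : t * @rsum L (fun n => a n) <= a 0%N - a L + D * @rsum L (fun n => e n).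
    elim: L => [|L IH]; first by rewrite !rsum0; lra.
    rewrite !rsum_recr; have := H L t t0; rewrite -/D => h.
    have : (1 + t) * (m * a L) <= (1 - t) * a L.
      have : (1 + t) * m <= 1 - t.
        by rewrite /t; have := Rle_0_sqr (1 - m); rewrite /Rsqr; nra.
      have := a0 L; nra.
    lra.
  have e1 : 0 <= @rsum L (fun n => e n) by apply: rsum_ge0.
  have s0 : 0 <= @rsum L (fun n => a n) by apply: rsum_ge0.
  have := a0 L; have := a0 0%N; move=> a00 aL.
  set s := rsum _ in HL s0 *; set r := rsum _ in HL e1 *.
  have i0 := Rinv_0_lt_compat _ t0.
  have -> : s = / t * (t * s) by field; lra.
  rewrite /Rdiv.
  have : / t * (t * s) <= / t * (a 0%N - a L + D * r) by apply: Rmult_le_compat_l; lra.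
  have : 0 <= / t * a L by nra.
  have : 0 <= D * / t * (a 0%N + a L).
    by apply: Rmult_le_pos; [nra|lra].
  have : 0 <= / t * r by nra.
  lra.
(* With [m = 1 + 2 t] the backward inequality leaves [t a n] beside the telescoping difference
   [(1 + t) (a (S n) - a n)]. *)
- set t := (m - 1) / 2; have t0 : 0 < t by rewrite /t; lra.
  have D1 : 0 < 1 + / t by have := Rinv_0_lt_compat _ t0; lra.
  set D := 1 + / t in D1.
  exists (D / t + (1 + t) / t); split.
    have : 0 < (1 + t) / t by apply: Rdiv_lt_0_compat; lra.
    have : 0 < D / t by apply: Rdiv_lt_0_compat.
    lra.
  move=> L a e a0 e0 _ H.
  have HL : t * @rsum L (fun n => a n) <= (1 + t) * (a L - a 0%N) + D * @rsum L (fun n => e n).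
    elim: L => [|L IH]; first by rewrite !rsum0; lra.
    rewrite !rsum_recr; have := H L t t0; rewrite -/D => h.
    have E : m = 1 + 2 * t by rewrite /t; lra.
    rewrite E in h; lra.
  have e1 : 0 <= @rsum L (fun n => e n) by apply: rsum_ge0.
  have s0 : 0 <= @rsum L (fun n => a n) by apply: rsum_ge0.
  have := a0 L; have := a0 0%N; move=> a00 aL.
  set s := rsum _ in HL s0 *; set r := rsum _ in HL e1 *.
  have i0 := Rinv_0_lt_compat _ t0.
  have -> : s = / t * (t * s) by field; lra.
  rewrite /Rdiv.
  have : / t * (t * s) <= / t * ((1 + t) * (a L - a 0%N) + D * r) by apply: Rmult_le_compat_l; lra.
  have P : 0 <= (1 + t) * / t by nra.
  have : 0 <= (1 + t) * / t * a 0%N by nra.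
  have : 0 <= (1 + t) * / t * r by nra.
  have : 0 <= D * / t * (a 0%N + a L).
    by apply: Rmult_le_pos; [nra|lra].
  lra.
Qed.

(** * The energy estimate for hyperbolic recurrences *)

Definition re_part {d} (v : cvec d) : Rd d := fun i => fst (v i).
Definition im_part {d} (v : cvec d) : Rd d := fun i => snd (v i).
Definition cnsq {d} (v : cvec d) : R := nsq (re_part v) + nsq (im_part v).

Definition rdefect {d} (A : Mat d) (w : nat -> Rd d) (n : nat) : Rd d :=
  vsub (w (S n)) (mv A (w n)).
Definition cdefect {d} (A : Mat d) (v : nat -> cvec d) (n : nat) : cvec d :=
  fun i => (rdefect A (fun k => re_part (v k)) n i, rdefect A (fun k => im_part (v k)) n i).

Lemma cnsq_ge0 {d} (v : cvec d) : 0 <= cnsq v.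
Proof. have := nsq_ge0 (re_part v); have := nsq_ge0 (im_part v); rewrite /cnsq; lra. Qed.

Lemma mv_comb {d} (A : Mat d) (a b : R) (x y z : Rd d) i :
  mv A (fun j => x j - (a * y j + b * z j)) i = mv A x i - (a * mv A y i + b * mv A z i).
Proof.
rewrite /mv -!rsum_scal -rsum_add -rsum_sub; apply: eq_rsum => j; ring.
Qed.

Lemma mv_vsub {d} (A : Mat d) (x y : Rd d) i :
  mv A (vsub x y) i = mv A x i - mv A y i.
Proof. rewrite /mv -rsum_sub; apply: eq_rsum => j; rewrite /vsub; ring. Qed.

Definition hs_sq {d} (A : Mat d) : R := rsum (fun i => rsum (fun j => A i j * A i j)).

Lemma hs_sq_ge0 {d} (A : Mat d) : 0 <= hs_sq A.
Proof. by apply: rsum_ge0 => i; apply: rsum_ge0 => j; exact: Rle_0_sqr. Qed.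

Lemma nsq_mv_le {d} (A : Mat d) (v : Rd d) : nsq (mv A v) <= hs_sq A * nsq v.
Proof.
rewrite /nsq [_ * _]Rmult_comm /hs_sq -rsum_scal; apply: rsum_le => i.
rewrite [X in _ <= X]Rmult_comm; exact: cauchy_schwarz.
Qed.

Lemma nsq_comb3 {d} (a b : R) (x y z w : Rd d) :
  (forall i, w i = x i - (a * y i + b * z i)) ->
  nsq w <= 3 * (nsq x + a * a * nsq y + b * b * nsq z).
Proof.
move=> H; rewrite -!nsq_scal /nsq -!rsum_add -rsum_scal; apply: rsum_le => i; rewrite H.
have := Rle_0_sqr (x i + a * y i); have := Rle_0_sqr (x i + b * z i).
have := Rle_0_sqr (a * y i - b * z i); rewrite /Rsqr; lra.
Qed.

Lemma cnsq_shift_apply {d} (A : Mat d) (mu : Defs.C) (v : cvec d) :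
  cnsq (shift_apply A mu v) <=
  3 * (hs_sq A + (fst mu * fst mu + snd mu * snd mu)) * cnsq v.
Proof.
case: mu => a b /=.
have H1 := nsq_comb3 a (- b) (mv A (re_part v)) (re_part v) (im_part v)
   (re_part (shift_apply A (a, b) v)).
have H2 := nsq_comb3 a b (mv A (im_part v)) (im_part v) (re_part v)
   (im_part (shift_apply A (a, b) v)).
have {}H1 := H1 (fun i => ltac:(rewrite /re_part /im_part /shift_apply /mv /=; ring)).
have {}H2 := H2 (fun i => ltac:(rewrite /re_part /im_part /shift_apply /mv /=; ring)).
have := nsq_mv_le A (re_part v); have := nsq_mv_le A (im_part v).
rewrite /cnsq; nra.
Qed.

(** The factor [A - mu] commutes with [A] and with the step in [n], so applying it to a solution
    applies it to the forcing term. *)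
Lemma cdefect_shift_apply {d} (A : Mat d) (mu : Defs.C) (v : nat -> cvec d) n i :
  cdefect A (fun k => shift_apply A mu (v k)) n i = shift_apply A mu (cdefect A v n) i.
Proof.
case: mu => a b; rewrite /cdefect /shift_apply /rdefect /=.
have E1 k : re_part (shift_apply A (a, b) (v k)) =
   (fun j => mv A (re_part (v k)) j - (a * re_part (v k) j + (- b) * im_part (v k) j)).
  by rewrite /re_part /shift_apply /mv /im_part /=; apply: functional_extensionality => j; ring.
have E2 k : im_part (shift_apply A (a, b) (v k)) =
   (fun j => mv A (im_part (v k)) j - (a * im_part (v k) j + b * re_part (v k) j)).
  by rewrite /re_part /shift_apply /mv /im_part /=; apply: functional_extensionality => j; ring.
have F1 := mv_vsub A (re_part (v n.+1)) (mv A (re_part (v n))) i.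
have F2 := mv_vsub A (im_part (v n.+1)) (mv A (im_part (v n))) i.
rewrite /mv /vsub in F1 F2.
rewrite /vsub; congr pair.
- rewrite -/(shift_apply A (a, b) (v n)) -/(shift_apply A (a, b) (v n.+1)) !E1 mv_comb F1 /mv; ring.
- rewrite -/(shift_apply A (a, b) (v n)) -/(shift_apply A (a, b) (v n.+1)) !E2 mv_comb F2 /mv; ring.
Qed.

Lemma eq_cnsq {d} (v w : cvec d) : (forall i, v i = w i) -> cnsq v = cnsq w.
Proof.
by move=> H; rewrite /cnsq; congr Rplus; apply: eq_nsq => i; rewrite /re_part /im_part H.
Qed.

(* The factor [A - mu] is peeled off: [(A - mu) v] solves the same kind of recurrence and is killed
   by the remaining factors, and [v] itself solves a scalar recurrence with multiplier [mu]. *)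
Lemma factored_energy_estimate {d} (A : Mat d) (s : list Defs.C) :
  (forall mu, In mu s -> Cmod mu <> 1) ->
  exists K, 0 < K /\ forall (L : nat) (v : nat -> cvec d),
    (forall n i, fold_right (fun mu u => shift_apply A mu u) (v n) s i = C0) ->
    @rsum L (fun n => cnsq (v n)) <=
    K * (@rsum L (fun n => cnsq (cdefect A v n)) + cnsq (v 0%N) + cnsq (v L)).
Proof.
(* The last entry of the list is the factor that [fold_right] applies first to [v], so the induction
   removes entries at that end. *)
elim/List.rev_ind: s => [|mu s IH] Hs.
  exists 1; split; first lra.
  move=> L v /= Hv.
  have E n : cnsq (v n) = 0.
    have -> : cnsq (v n) = cnsq (fun _ : 'I_d => C0) by apply: eq_cnsq.
    have Z : nsq (fun _ : 'I_d => 0) = 0 by exact: nsq_zero.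
    by rewrite /cnsq -[re_part _]/(fun _ : 'I_d => 0) -[im_part _]/(fun _ : 'I_d => 0) Z; lra.
  rewrite (eq_rsum _ (fun _ => 0)) // !E rsum_const.
  have : 0 <= @rsum L (fun n => cnsq (cdefect A v n)) by apply: rsum_ge0 => n; exact: cnsq_ge0.
  lra.
have [K2 [K20 H2]] := IH (fun nu h => Hs nu (in_or_app _ _ _ (or_introl h))).
set m := fst mu * fst mu + snd mu * snd mu.
have m0 : 0 <= m by rewrite /m; nra.
have m1 : m <> 1.
  move=> m1; apply: (Hs mu); first by apply: in_or_app; right; left.
  by rewrite /Cmod -/m m1 sqrt_1.
have [K1 [K10 H1]] := scalar_energy_estimate m m0 m1.
set B := 3 * (hs_sq A + m).
have B0 : 0 <= B by rewrite /B; have := hs_sq_ge0 A; lra.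
(* The forcing of the scalar recurrence costs twice the defect plus twice the energy of [t]; the
   latter is bounded through [K2] by the inductive estimate, and [B] is the price of one factor
   [A - mu]. The constant leaves some slack. *)
exists (K1 * (3 + 2 * (K2 * (B + B)))); split.
  by apply: Rmult_lt_0_compat => //; nra.
move=> L v Hv.
pose t n := shift_apply A mu (v n).
have {}H2 := H2 L t.
have {}Hv n i : fold_right (fun mu u => shift_apply A mu u) (t n) s i = C0.
  by have := Hv n i; rewrite fold_right_app.
have {}H2 := H2 Hv.
(* From [v (n+1) = A v n + defect] comes [v (n+1) = mu v n + g n], where [g] is the defect plus
   [t n = (A - mu) v n]. *)
pose g n : cvec d := fun i => (fst (cdefect A v n i) + fst (t n i), snd (cdefect A v n i) + snd (t n i)).
have Hg n : cnsq (g n) <= 2 * cnsq (cdefect A v n) + 2 * cnsq (t n).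
  have := nsq_add_le (re_part (cdefect A v n)) (re_part (t n)) (re_part (g n)) (fun i => erefl _).
  have := nsq_add_le (im_part (cdefect A v n)) (im_part (t n)) (im_part (g n)) (fun i => erefl _).
  rewrite /cnsq; lra.
pose muv n : cvec d := fun i => Cmul mu (v n i).
have Em n : cnsq (muv n) = m * cnsq (v n).
  rewrite /cnsq /nsq -!rsum_add -rsum_scal; apply: eq_rsum => i.
  rewrite /re_part /im_part /muv /Cmul /m /=; ring.
have Ev n : (forall i, re_part (v n.+1) i = re_part (muv n) i + re_part (g n) i) /\
            (forall i, im_part (v n.+1) i = im_part (muv n) i + im_part (g n) i).
  split=> i; rewrite /re_part /im_part /muv /g /t /cdefect /rdefect /shift_apply /vsub /mv
    /re_part /im_part /=; ring.
have a0 n : 0 <= cnsq (v n) by exact: cnsq_ge0.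
have e0 n : 0 <= cnsq (g n) by exact: cnsq_ge0.
have Y1 n q : 0 < q -> cnsq (v n.+1) <= (1 + q) * (m * cnsq (v n)) + (1 + / q) * cnsq (g n).
  move=> q0; rewrite -Em; have [Er Ei] := Ev n.
  have := nsq_young q _ _ _ q0 Er; have := nsq_young q _ _ _ q0 Ei.
  rewrite /cnsq; lra.
have Y2 n q : 0 < q -> m * cnsq (v n) <= (1 + q) * cnsq (v n.+1) + (1 + / q) * cnsq (g n).
  move=> q0; rewrite -Em; have [Er Ei] := Ev n.
  have N (x : Rd d) : nsq (fun i => (-1) * x i) = nsq x by rewrite nsq_scal; lra.
  have := nsq_young q (re_part (v n.+1)) (fun i => (-1) * re_part (g n) i) (re_part (muv n)) q0
    (fun i => ltac:(rewrite Er; ring)).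
  have := nsq_young q (im_part (v n.+1)) (fun i => (-1) * im_part (g n) i) (im_part (muv n)) q0
    (fun i => ltac:(rewrite Ei; ring)).
  rewrite /cnsq !N; lra.
have {Y1 Y2}H1 := H1 L (fun n => cnsq (v n)) (fun n => cnsq (g n)) a0 e0 Y1 Y2.
have G : @rsum L (fun n => cnsq (g n)) <=
   2 * @rsum L (fun n => cnsq (cdefect A v n)) + 2 * @rsum L (fun n => cnsq (t n)).
  by rewrite -!rsum_scal -rsum_add; apply: rsum_le => i; exact: Hg.
have T n : cnsq (t n) <= B * cnsq (v n) by exact: cnsq_shift_apply.
have D : @rsum L (fun n => cnsq (cdefect A t n)) <= B * @rsum L (fun n => cnsq (cdefect A v n)).
  rewrite -rsum_scal; apply: rsum_le => i.
  rewrite (eq_cnsq _ _ (cdefect_shift_apply A mu v i)); exact: cnsq_shift_apply.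
set X := @rsum L (fun n => cnsq (cdefect A v n)) in G D *.
set Y := @rsum L (fun n => cnsq (cdefect A t n)) in H2 D.
set Z := @rsum L (fun n => cnsq (t n)) in G H2.
have X0 : 0 <= X by apply: rsum_ge0 => i; exact: cnsq_ge0.
apply: (Rle_trans _ _ _ H1).
rewrite Rmult_assoc; apply: Rmult_le_compat_l; first lra.
set s0 := cnsq (v 0%N); set sL := cnsq (v L).
have p0 : 0 <= s0 by apply: a0.
have pL : 0 <= sL by apply: a0.
have Z1 : Z <= K2 * ((B + B) * (X + s0 + sL)).
  apply: (Rle_trans _ _ _ H2); apply: Rmult_le_compat_l; first lra.
  have := T 0%N; have := T L; rewrite -/s0 -/sL.
  have : 0 <= B * (X + s0 + sL) by apply: Rmult_le_pos; lra.
  lra.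
set W := K2 * (B + B).
have : 2 * Z <= 2 * W * (X + s0 + sL) by rewrite /W; lra.
rewrite -/W; lra.
Qed.

(** The eigenvalues of a real matrix may be complex, which is why the factored estimate concerns
    complex sequences; here the imaginary part is zero. *)
Lemma hyperbolic_energy_estimate {d} (A : Mat d) : hyperbolic A ->
  exists K, 0 < K /\ forall (L : nat) (w : nat -> Rd d),
    @rsum L (fun n => nsq (w n)) <=
    K * (@rsum L (fun n => nsq (rdefect A w n)) + nsq (w 0%N) + nsq (w L)).
Proof.
case=> _ HA; have [s [Hs H0]] := Annihilation.annihilating_eigenvalues A.
have [K [K0 HK]] := factored_energy_estimate A s (fun mu h => HA mu (Hs mu h)).
exists K; split=> // L w.
have := HK L (fun n i => (w n i, 0)) (fun n => H0 _).
have Z : nsq (fun _ : 'I_d => 0) = 0 by exact: nsq_zero.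
have E n : cnsq (fun i => (w n i, 0)) = nsq (w n).
  rewrite /cnsq -[re_part _]/(w n) -[im_part _]/(fun _ : 'I_d => 0) Z; lra.
rewrite !E (eq_rsum _ (fun n : 'I_L => nsq (w n))); last by move=> i; exact: E.
rewrite (eq_rsum (fun n : 'I_L => cnsq _) (fun n => nsq (rdefect A w n))) // => n.
rewrite /cnsq -[re_part _]/(rdefect A w n).
have -> : im_part (cdefect A (fun (n0 : nat) (i : 'I_d) => (w n0 i, 0)) n) = (fun _ => 0).
  apply: functional_extensionality => i.
  rewrite /im_part /cdefect /rdefect /vsub /im_part /= /mv.
  rewrite (eq_rsum _ (fun _ => 0)) ?rsum_const; [lra|by move=> j; rewrite Rmult_0_r].
rewrite Z; lra.
Qed.

(** A perturbation of relative size [c = / (4 K)] contributes at most half of the sum being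
    estimated. That sum is finite, so it can be absorbed on the left. *)
Lemma perturbed_energy_estimate {d} (A : Mat d) : hyperbolic A ->
  exists K c, 0 < K /\ 0 < c /\ forall (L : nat) (w h : nat -> Rd d),
    (forall n, (n < L)%coq_nat -> nsq (vsub (rdefect A w n) (h n)) <= c * nsq (w n)) ->
    @rsum L (fun n => nsq (w n)) <=
    K * (@rsum L (fun n => nsq (h n)) + nsq (w 0%N) + nsq (w L)).
Proof.
move/hyperbolic_energy_estimate => [K [K0 HK]].
exists (4 * K), (/ (4 * K)); split; first lra.
have i0 : 0 < / (4 * K) by apply: Rinv_0_lt_compat; lra.
split=> // L w h Hw.
have H : @rsum L (fun n => nsq (rdefect A w n)) <=
   2 * @rsum L (fun n => nsq (h n)) + 2 * (/ (4 * K) * @rsum L (fun n => nsq (w n))).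
  rewrite -!rsum_scal -rsum_add; apply: rsum_le => i.
  have := Hw i (elimT ltP (ltn_ord i)).
  have := nsq_add_le (h i) (vsub (rdefect A w i) (h i)) (rdefect A w i)
    (fun j => ltac:(rewrite /vsub; ring)).
  lra.
have := HK L w.
set S := @rsum L (fun n => nsq (w n)) in H *; set X := rsum _ in H *; set Y := rsum _ in H *.
have : K * X <= K * (2 * Y + 2 * (/ (4 * K) * S)) by apply: Rmult_le_compat_l; lra.
have -> : K * (2 * Y + 2 * (/ (4 * K) * S)) = 2 * K * Y + S / 2 by field; lra.
have := nsq_ge0 (w 0%N); have := nsq_ge0 (w L); move=> wL w0.
have : 0 <= K * nsq (w 0%N) by apply: Rmult_le_pos; lra.
have : 0 <= K * nsq (w L) by apply: Rmult_le_pos; lra.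
lra.
Qed.

(** * Limits along an ultrafilter *)

Record nonprincipal_ultrafilter (U : (nat -> Prop) -> Prop) : Prop := {
  ultra_mono : forall P Q, U P -> (forall k, P k -> Q k) -> U Q;
  ultra_and : forall P Q, U P -> U Q -> U (fun k => P k /\ Q k);
  ultra_ex : forall P, U P -> exists k, P k;
  ultra_em : forall P, U P \/ U (fun k => ~ P k);
  ultra_tail : forall N, U (fun k => (N <= k)%coq_nat) }.

Arguments ultra_mono {U}. Arguments ultra_and {U}. Arguments ultra_ex {U}.
Arguments ultra_em {U}. Arguments ultra_tail {U}.

Section Existence.
Import boolp classical_sets filter.

Lemma nonprincipal_ultrafilter_exists : exists U, nonprincipal_ultrafilter U.
Proof.
have [G [GU sub]] := ultraFilterLemma eventually_filter.
exists G; split.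
- by move=> P Q GP H; apply: filterS GP.
- by move=> P Q; exact: filterI.
- by move=> P /filter_ex.
- by move=> P; exact: in_ultra_setVsetC.
- by move=> N; apply: sub; exists N => // k /= Nk; apply/leP.
Qed.

End Existence.

Section Ultralimits.
Context {U : (nat -> Prop) -> Prop} (HU : nonprincipal_ultrafilter U).

Lemma ultra_all (P : nat -> Prop) : (forall k, P k) -> U P.
Proof. by move=> H; apply: (ultra_mono HU _ _ (ultra_tail HU 0)) => k _. Qed.

Lemma ultra_not (P : nat -> Prop) : ~ U P -> U (fun k => ~ P k).
Proof. by case: (ultra_em HU P). Qed.

Lemma ultra_finite_all {T : Type} (l : list T) (P : T -> nat -> Prop) :
  (forall t, U (P t)) -> U (fun k => forall t, In t l -> P t k).
Proof.
move=> H; elim: l => [|t l IH]; first exact: ultra_all.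
apply: (ultra_mono HU _ _ (ultra_and HU _ _ (H t) IH)) => k [h1 h2] u [<-//|/h2].
by [].
Qed.

Definition ulim (u : nat -> R) (l : R) : Prop := forall eps, 0 < eps -> U (fun k => Rabs (u k - l) < eps).

(** The limit is the supremum of the levels that [u] reaches on a set belonging to [U]. *)
Lemma ulim_exists (u : nat -> R) (b : R) : (forall k, Rabs (u k) <= b) -> exists l, ulim u l.
Proof.
move=> Hb; pose E a := U (fun k => a <= u k).
have Eb : bound E.
  exists b => a /(ultra_ex HU) [k Hk]; have := Hb k; have := Rle_abs (u k); lra.
have En : exists a, E a.
  exists (- b); apply: ultra_all => k; have := Hb k; have := Rle_abs (- u k); rewrite Rabs_Ropp; lra.
have [l [lub1 lub2]] := completeness E Eb En.
exists l => e e0.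
have H1 : U (fun k => l - e < u k).
  apply: NNPP => H.
  have : l <= l - e / 2; last lra.
  apply: lub2 => a Ea; apply: Rnot_lt_le => ha; apply: H.
  by apply: (ultra_mono HU _ _ Ea) => k; lra.
have H2 : U (fun k => u k < l + e).
  have : U (fun k => ~ (l + e <= u k)).
    by apply: ultra_not => H; have := lub1 _ H; lra.
  by move/(ultra_mono HU); apply => k; lra.
apply: (ultra_mono HU _ _ (ultra_and HU _ _ H1 H2)) => k [h1 h2]; apply: Rabs_def1; lra.
Qed.

Lemma ulim_le (u : nat -> R) (l b : R) : ulim u l -> U (fun k => u k <= b) -> l <= b.
Proof.
move=> Hu Hb; apply: Rnot_lt_le => h.
have := Hu (l - b) ltac:(lra) => h1.
have [k [/Rabs_def2 [h2 h3] h4]] := ultra_ex HU _ (ultra_and HU _ _ h1 Hb); lra.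
Qed.

Lemma ulim_continuous (g : R -> R) (u : nat -> R) (l : R) :
  continuity_pt g l -> ulim u l -> ulim (fun k => g (u k)) (g l).
Proof.
move=> Hg Hu e e0; have [del [d0 Hd]] := Hg e e0.
apply: (ultra_mono HU _ _ (Hu del d0)) => k hk.
(* [continuity_pt] speaks only of points different from [l]. *)
case: (Req_dec (u k) l) => [->|ne]; first by rewrite Rminus_diag Rabs_R0.
by apply: Hd; split => //; split => //; apply: not_eq_sym.
Qed.

Lemma ulim_add (u v : nat -> R) (l m : R) : ulim u l -> ulim v m -> ulim (fun k => u k + v k) (l + m).
Proof.
move=> Hu Hv e e0; have := ultra_and HU _ _ (Hu (e / 2) ltac:(lra)) (Hv (e / 2) ltac:(lra)).
move/(ultra_mono HU); apply => k [/Rabs_def2 h1 /Rabs_def2 h2]; apply: Rabs_def1; lra.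
Qed.

Lemma ulim_const (c : R) : ulim (fun _ => c) c.
Proof. by move=> e e0; apply: ultra_all => k; rewrite Rminus_diag Rabs_R0. Qed.

Lemma ulim_minus_const (u : nat -> R) (l c : R) : ulim u l -> ulim (fun k => u k - c) (l - c).
Proof. by move=> Hu; apply: ulim_add => //; exact: ulim_const. Qed.

Lemma ulim_sq (u : nat -> R) (l : R) : ulim u l -> ulim (fun k => u k * u k) (l * l).
Proof.
by apply: (ulim_continuous (fun x => x * x)); apply: derivable_continuous_pt; reg.
Qed.

Lemma ulim_rsum {n} (F : nat -> 'I_n -> R) (l : 'I_n -> R) :
  (forall i, ulim (fun k => F k i) (l i)) -> ulim (fun k => rsum (F k)) (rsum l).
Proof.
move=> H; rewrite /rsum.
elim: (index_enum _) => [|i s IH].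
  have -> : (fun k => \big[Rplus/0]_(i <- [::]) F k i) = fun _ => 0.
    by apply: functional_extensionality => k; rewrite big_nil.
  by rewrite big_nil; exact: ulim_const.
have -> : (fun k => \big[Rplus/0]_(i <- i :: s) F k i) =
   fun k => F k i + \big[Rplus/0]_(i <- s) F k i.
  by apply: functional_extensionality => k; rewrite big_cons.
by rewrite big_cons; apply: ulim_add.
Qed.

Definition vulim {d} (u : nat -> Rd d) (l : Rd d) : Prop := forall i, ulim (fun k => u k i) (l i).

Lemma vulim_exists {d} (u : nat -> Rd d) (b : R) : 0 <= b -> (forall k, nsq (u k) <= b * b) ->
  exists l, vulim u l.
Proof.
move=> b0 H.
have /(_ _)/constructive_indefinite_description E i : exists l, ulim (fun k => u k i) l.
  by apply: (ulim_exists _ b) => k; apply: nsq_coord_abs.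
by exists (fun i => proj1_sig (E i)) => i; exact: (proj2_sig (E i)).
Qed.

Lemma ulim_nsq {d} (u : nat -> Rd d) (l : Rd d) : vulim u l -> ulim (fun k => nsq (u k)) (nsq l).
Proof. by move=> H; apply: ulim_rsum => i; apply: ulim_sq. Qed.

Lemma vulim_vsub {d} (u : nat -> Rd d) (l c : Rd d) : vulim u l -> vulim (fun k => vsub (u k) c) (vsub l c).
Proof. by move=> H i; apply: ulim_minus_const. Qed.

Lemma vulim_nsq_lt {d} (u : nat -> Rd d) (l : Rd d) (e : R) : vulim u l -> 0 < e ->
  U (fun k => nsq (vsub (u k) l) < e).
Proof.
move=> /(vulim_vsub _ _ l) /ulim_nsq H e0.
have := H e e0; rewrite (eq_nsq (vsub l l) (vzero d)) ?nsq_zero; last by move=> i; rewrite /vsub /vzero; lra.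
by move/(ultra_mono HU); apply => k /Rabs_def2; lra.
Qed.

Lemma vulim_of_nsq {d} (u : nat -> Rd d) (l : Rd d) :
  (forall e, 0 < e -> U (fun k => nsq (vsub (u k) l) < e)) -> vulim u l.
Proof.
move=> H i e e0; apply: (ultra_mono HU _ _ (H (e * e) (Rmult_lt_0_compat _ _ e0 e0))) => k hk.
have h2 : (u k i - l i) * (u k i - l i) <= nsq (vsub (u k) l) by exact: nsq_coord.
apply: Rabs_def1; nra.
Qed.

Lemma ulim_unique (u : nat -> R) (l m : R) : ulim u l -> ulim u m -> l = m.
Proof.
move=> H1 H2; apply: NNPP => ne.
have e0 : 0 < Rabs (l - m) / 2 by have := Rabs_pos_lt (l - m) (Rminus_eq_contra _ _ ne); lra.
have [k [h1 h2]] := ultra_ex HU _ (ultra_and HU _ _ (H1 _ e0) (H2 _ e0)).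
have := Rabs_triang (l - u k) (u k - m); have -> : l - u k + (u k - m) = l - m by ring.
rewrite (Rabs_minus_sym l (u k)); lra.
Qed.

End Ultralimits.

(** * Lipschitz and linearization estimates *)

Definition vline {d} (x w : Rd d) (t : R) : Rd d := fun i => x i + t * w i.

Lemma vnorm_ge0 {d} (v : Rd d) : 0 <= vnorm v.
Proof. exact: sqrt_pos. Qed.

Lemma vnorm_sq {d} (v : Rd d) : vnorm v * vnorm v = nsq v.
Proof. by apply: sqrt_sqrt; exact: nsq_ge0. Qed.

Lemma vnorm_coord {d} (v : Rd d) i : Rabs (v i) <= vnorm v.
Proof. apply: nsq_coord_abs; [exact: vnorm_ge0|rewrite vnorm_sq; lra]. Qed.

Lemma vnorm_scal {d} (c : R) (v : Rd d) : vnorm (fun i => c * v i) = Rabs c * vnorm v.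
Proof.
rewrite -[LHS]/(sqrt (nsq (fun i => c * v i))) nsq_scal sqrt_mult; [|nra|exact: nsq_ge0].
by rewrite -[c * c]/(Rsqr c) sqrt_Rsqr_abs.
Qed.

Lemma mv_scal {d} (A : Mat d) (c : R) (v : Rd d) i : mv A (fun j => c * v j) i = c * mv A v i.
Proof. rewrite /mv -rsum_scal; apply: eq_rsum => j; ring. Qed.

Definition line_derivable {d} (F : Rd d -> Rd d) (D : Rd d -> Mat d) : Prop :=
  forall x w i t, derivable_pt_lim (fun s => F (vline x w s) i) t (mv (D (vline x w t)) w i).

Lemma is_C1_line_derivable {d} (f : R -> Rd d -> Rd d) Dl Dx th :
  is_C1_S1 f Dl Dx -> line_derivable (f th) (Dx th).
Proof.
case=> _ [H _] x w i t eps e0.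
have n0 := vnorm_ge0 w; set nw := vnorm w in n0 *.
(* The Frechet remainder for the increment [h w] is at most this number times |h| |w|, hence below
   [eps] |h|; the [+ 1] covers [w = 0]. *)
have e1 : 0 < eps / (2 * (nw + 1)) by apply: Rdiv_lt_0_compat; lra.
have [del [d0 Hd]] := H th (vline x w t) _ e1.
have d1 : 0 < del / (nw + 1) by apply: Rdiv_lt_0_compat; lra.
exists (mkposreal _ d1) => h h0 /= hd.
have a0 := Rabs_pos_lt h h0.
have hd' : Rabs h * (nw + 1) < del.
  have := Rmult_lt_compat_r (nw + 1) _ _ ltac:(lra) hd.
  by rewrite /Rdiv Rmult_assoc Rinv_l ?Rmult_1_r //; lra.
have := Hd 0 (fun j => h * w j).
rewrite Rabs_R0 vnorm_scal Rplus_0_l Rplus_0_r -/nw.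
have -> : vadd (vline x w t) (fun j => h * w j) = vline x w (t + h).
  by apply: functional_extensionality => j; rewrite /vadd /vline; ring.
have h1 : Rabs h * nw < del by nra.
move/(_ h1); set v : Rd d := fun _ => _ => Hv.
have := vnorm_coord v i; rewrite {1}/v mv_scal.
set P := f th (vline x w (t + h)) i; set Q := f th (vline x w t) i; set M := mv _ _ _ => Hi.
have -> : (P - Q) / h - M = / h * (P - Q - 0 * Dl th (vline x w t) i - h * M) by field.
rewrite Rabs_mult Rabs_inv.
have Hj := Rle_trans _ _ _ Hi Hv.
have i0 := Rinv_0_lt_compat _ a0.
apply: (Rle_lt_trans _ (/ Rabs h * (eps / (2 * (nw + 1)) * (Rabs h * nw)))).
  by apply: Rmult_le_compat_l => //; lra.
have -> : / Rabs h * (eps / (2 * (nw + 1)) * (Rabs h * nw)) = eps / (2 * (nw + 1)) * nw by field; lra.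
have : eps / (2 * (nw + 1)) * (nw + 1) = eps / 2 by field; lra.
nra.
Qed.

(** The mean value theorem holds only coordinate by coordinate, with an intermediate point depending
    on [i]. Hence the closeness of [D] to [A] is required entrywise, and one factor [INR d] comes
    from the entries of a row, the other from the rows. *)
Lemma line_remainder {d} (F : Rd d -> Rd d) (D : Rd d -> Mat d) (A : Mat d) (x y : Rd d) (eta : R) :
  line_derivable F D ->
  (forall t i j, 0 <= t <= 1 -> Rabs (D (vline x (vsub y x) t) i j - A i j) <= eta) ->
  nsq (fun i => F y i - F x i - mv A (vsub y x) i) <=
  INR d * (INR d * (eta * eta)) * nsq (vsub y x).
Proof.
move=> HF Heta; set w := vsub y x.
rewrite Rmult_assoc; apply: rsum_le_const => i.
have [c [Hc [c0 c1]]] : exists c, F y i - F x i = mv (D (vline x w c)) w i /\ 0 < c < 1.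
  have [c [Hc c01]] := MVT_cor2 (fun s => F (vline x w s) i) (fun t => mv (D (vline x w t)) w i)
    0 1 Rlt_0_1 (fun t _ => HF x w i t).
  exists c; split => //; rewrite Rminus_0_r Rmult_1_r in Hc; rewrite -Hc.
  congr (F _ i - F _ i); apply: functional_extensionality => j;
    rewrite /vline /w /vsub; ring.
rewrite Hc.
have -> : mv (D (vline x w c)) w i - mv A w i =
   rsum (fun j => (D (vline x w c) i j - A i j) * w j).
  by rewrite /mv -rsum_sub; apply: eq_rsum => j; ring.
apply: (Rle_trans _ _ _ (cauchy_schwarz _ _)).
apply: Rmult_le_compat_r; first exact: nsq_ge0.
apply: rsum_le_const => j.
have := Heta c i j ltac:(lra); rewrite -/w => h.
move: h; set z := _ - _ => h; have := Rabs_pos z.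
have -> : z * z = Rabs z * Rabs z by rewrite -Rabs_mult Rabs_pos_eq //; exact: Rle_0_sqr.
by move=> z0; apply: Rmult_le_compat.
Qed.

Lemma nsq_vline_le {d} (x y : Rd d) (t b : R) : 0 <= t <= 1 -> nsq x <= b -> nsq y <= b ->
  nsq (vline x (vsub y x) t) <= b.
Proof.
move=> t01 hx hy.
have : nsq (vline x (vsub y x) t) <= (1 - t) * nsq x + t * nsq y.
  rewrite /nsq -!rsum_scal -rsum_add; apply: rsum_le => i; rewrite /vline /vsub.
  have : 0 <= t * (1 - t) * ((x i - y i) * (x i - y i)).
    by apply: Rmult_le_pos; [nra|exact: Rle_0_sqr].
  lra.
nra.
Qed.

Definition uniformly_equicontinuous {d} (D : Z -> Rd d -> Mat d) : Prop :=
  forall M eps, 0 < M -> 0 < eps -> exists del, 0 < del /\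
    forall n x y i j, nsq x <= M * M -> nsq y <= M * M -> vnorm (vsub x y) < del ->
      Rabs (D n x i j - D n y i j) <= eps.

Lemma Z_bounded (g : Z -> R) :
  (exists N b, forall n, (N <= n)%Z -> g n <= b) ->
  (exists N b, forall n, (n <= N)%Z -> g n <= b) ->
  exists b, forall n, g n <= b.
Proof.
move=> [N1 [b1 H1]] [N2 [b2 H2]].
have [b Hb] : exists b, forall n, (N2 <= n < N2 + Z.of_nat (Z.to_nat (N1 - N2)))%Z -> g n <= b.
  elim: (Z.to_nat _) => [|m [b Hb]]; first by exists 0 => n; lia.
  exists (Rmax b (g (N2 + Z.of_nat m)%Z)) => n Hn.
  case: (Z.eq_dec n (N2 + Z.of_nat m)) => [->|ne]; first exact: Rmax_r.
  by apply: Rle_trans (Rmax_l _ _); apply: Hb; lia.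
exists (Rmax b (Rmax b1 b2)) => n.
case: (Z_le_gt_dec N1 n) => h1.
  by apply: (Rle_trans _ _ _ (H1 n h1)); apply: Rle_trans (Rmax_r _ _); exact: Rmax_l.
case: (Z_le_gt_dec n N2) => h2.
  by apply: (Rle_trans _ _ _ (H2 n h2)); apply: Rle_trans (Rmax_r _ _); exact: Rmax_r.
by apply: Rle_trans (Rmax_l _ _); apply: Hb; lia.
Qed.

Definition abs_sum {d} (A : Mat d) : R := rsum (fun i => rsum (fun j => Rabs (A i j))).

Lemma abs_sum_coord {d} (A : Mat d) i j : Rabs (A i j) <= abs_sum A.
Proof.
apply: (Rle_trans _ (rsum (fun j => Rabs (A i j)))).
  by apply: (rsum_term_le (fun j => Rabs (A i j))) => k; exact: Rabs_pos.
apply: (rsum_term_le (fun i => rsum (fun j => Rabs (A i j)))) => k.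
by apply: rsum_ge0 => l; exact: Rabs_pos.
Qed.

Lemma abs_sum_le {d} (A B : Mat d) e : (forall i j, Rabs (A i j - B i j) <= e) ->
  abs_sum A <= INR d * (INR d * (abs_sum B + e)).
Proof.
move=> H; apply: rsum_le_const => i; apply: rsum_le_const => j.
have := H i j; have := abs_sum_coord B i j; have := Rabs_triang (A i j - B i j) (B i j).
have -> : A i j - B i j + B i j = A i j by ring.
lra.
Qed.

(** The limits at both ends bound the derivatives at the origin uniformly in [n]. Equicontinuity
    carries the bound to [x] in [m] equal steps shorter than [del], each adding at most [1]. *)
Lemma derivative_bounded {d} (D : Z -> Rd d -> Mat d) (ap am : Mat d) :
  uniformly_equicontinuous D ->
  (exists N, forall n i j, (N <= n)%Z -> Rabs (D n (vzero d) i j - ap i j) <= 1) ->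
  (exists N, forall n i j, (n <= N)%Z -> Rabs (D n (vzero d) i j - am i j) <= 1) ->
  forall M, 0 < M -> exists B, 0 <= B /\ forall n x i j, nsq x <= M * M -> Rabs (D n x i j) <= B.
Proof.
move=> HD [N1 H1] [N2 H2] M M0.
have [B0 HB0] : exists b, forall n, abs_sum (D n (vzero d)) <= b.
  apply: Z_bounded.
  - exists N1, (INR d * (INR d * (abs_sum ap + 1))) => n hn.
    by apply: abs_sum_le => i j; exact: H1.
  - exists N2, (INR d * (INR d * (abs_sum am + 1))) => n hn.
    by apply: abs_sum_le => i j; exact: H2.
have [del [d0 Hdel]] := HD M 1 M0 Rlt_0_1.
have [m [m1 m2]] : exists m : nat, 0 < INR m /\ M < INR m * del.
  have [m Hm] := INR_unbounded (M / del).
  have P : 0 < M / del by apply: Rdiv_lt_0_compat.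
  exists m; split; first lra.
  have := Rmult_lt_compat_r del _ _ d0 Hm.
  by rewrite /Rdiv Rmult_assoc Rinv_l ?Rmult_1_r //; lra.
have Bn : 0 <= Rabs B0 by exact: Rabs_pos.
exists (Rabs B0 + INR m); split; first lra.
move=> n x i j hx.
have nx : vnorm x <= M by apply: nsq_le_vnorm; lra.
have K (k : nat) : (k <= m)%coq_nat -> Rabs (D n (fun l => INR k / INR m * x l) i j) <= Rabs B0 + INR k.
  elim: k => [|k IH] hk.
    have -> : (fun l => INR 0 / INR m * x l) = vzero d.
      by apply: functional_extensionality => l; rewrite /vzero /=; field; lra.
    have := abs_sum_coord (D n (vzero d)) i j; have := HB0 n; have := Rle_abs B0; rewrite /=; lra.
  have {}IH := IH ltac:(lia).
  have ball (l : nat) : (l <= m)%coq_nat -> nsq (fun a => INR l / INR m * x a) <= M * M.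
    move=> /le_INR hl; rewrite nsq_scal.
    have q0 : 0 <= INR l / INR m by apply: Rmult_le_pos; [exact: pos_INR|have := Rinv_0_lt_compat _ m1; lra].
    have q1 : INR l / INR m <= 1.
      by apply: (Rmult_le_reg_r (INR m)) => //; rewrite /Rdiv Rmult_assoc Rinv_l; lra.
    move: q0 q1; set q := _ / _ => q0 q1.
    have qq : q * q <= 1 by nra.
    have := Rmult_le_compat_r _ _ _ (nsq_ge0 x) qq; lra.
  have step : Rabs (D n (fun l => INR k.+1 / INR m * x l) i j - D n (fun l => INR k / INR m * x l) i j) <= 1.
    apply: Hdel; [by apply: ball|by apply: ball; lia|].
    have -> : vsub (fun l => INR k.+1 / INR m * x l) (fun l => INR k / INR m * x l) = (fun l => / INR m * x l).
      by apply: functional_extensionality => l; rewrite /vsub S_INR; field; lra.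
    have i0 := Rinv_0_lt_compat _ m1.
    rewrite vnorm_scal Rabs_pos_eq; last lra.
    apply: (Rmult_lt_reg_l (INR m)) => //; rewrite -Rmult_assoc Rinv_r; lra.
  move: IH step; set p := D n (fun l => INR k / INR m * x l) i j; set q := D n (fun l => INR k.+1 / INR m * x l) i j => IH step.
  rewrite S_INR; have := Rabs_triang p (q - p); have -> : p + (q - p) = q by ring.
  lra.
have := K m (Nat.le_refl m).
have -> // : (fun l => INR m / INR m * x l) = x.
by apply: functional_extensionality => l; field; lra.
Qed.

Definition uniformly_lipschitz_on_balls {d} (F : Z -> Rd d -> Rd d) : Prop :=
  forall M, 0 < M -> exists L, 0 < L /\ forall n x y, nsq x <= M * M -> nsq y <= M * M ->
    nsq (vsub (F n y) (F n x)) <= L * nsq (vsub y x).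

Lemma lipschitz_of_bounded_derivative {d} (F : Z -> Rd d -> Rd d) (D : Z -> Rd d -> Mat d) :
  (forall n, line_derivable (F n) (D n)) ->
  (forall M, 0 < M -> exists B, 0 <= B /\ forall n x i j, nsq x <= M * M -> Rabs (D n x i j) <= B) ->
  uniformly_lipschitz_on_balls F.
Proof.
move=> HF HB M M0; have [B [B0 H]] := HB M M0.
have dd := pos_INR d.
have P : 0 <= INR d * (INR d * (B * B)) by repeat apply: Rmult_le_pos.
(* Comparison with the zero matrix in [line_remainder]; the [+ 1] keeps the constant positive. *)
exists (INR d * (INR d * (B * B)) + 1); split; first lra.
move=> n x y hx hy.
have := line_remainder (F n) (D n) (fun _ _ => 0) x y B (HF n).
have -> : (fun i => F n y i - F n x i - mv (fun _ _ => 0) (vsub y x) i) = vsub (F n y) (F n x).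
  apply: functional_extensionality => i; rewrite /mv.
  rewrite (eq_rsum _ (fun _ => 0)) ?rsum_const /vsub; [lra|move=> j; lra].
move=> /(_ (fun t i j ht => ltac:(rewrite Rminus_0_r; apply: H; exact: nsq_vline_le))).
have := nsq_ge0 (vsub y x); nra.
Qed.

Lemma linearization_remainder {d} (F : Z -> Rd d -> Rd d) (D : Z -> Rd d -> Mat d) (A : Mat d) (sg : Z) :
  (forall n, line_derivable (F n) (D n)) -> uniformly_equicontinuous D ->
  (forall eps, 0 < eps -> exists N, forall n i j, (N <= sg * n)%Z ->
     Rabs (D n (vzero d) i j - A i j) <= eps) ->
  forall c, 0 < c -> exists rho N, 0 < rho /\ forall n x y, (N <= sg * n)%Z ->
    nsq x <= rho -> nsq y <= rho ->
    nsq (fun i => F n y i - F n x i - mv A (vsub y x) i) <= c * nsq (vsub y x).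
Proof.
move=> HF HD HA c c0.
have dd := pos_INR d.
(* Chosen so that [d^2 eta^2 <= c] for [eta = sqrt e2]. Half of [eta] pays for moving from the
   segment to the origin, half for replacing the derivative there by [A]. *)
set e2 := c / (INR d * INR d + 1).
have e20 : 0 < e2 by apply: Rdiv_lt_0_compat; nra.
have eta0 := sqrt_lt_R0 _ e20; have eta2 := sqrt_sqrt e2 ltac:(lra).
set eta := sqrt e2 in eta0 eta2.
have [del [d0 Hd]] := HD 1 (eta / 2) Rlt_0_1 ltac:(lra).
have [N HN] := HA (eta / 2) ltac:(lra).
set r := Rmin 1 (del / 2).
have r0 : 0 < r by apply: Rmin_glb_lt; lra.
have r1 : r <= 1 by exact: Rmin_l.
have r2 : r <= del / 2 by exact: Rmin_r.
exists (r * r), N; split; first by apply: Rmult_lt_0_compat.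
move=> n x y hn hx hy.
apply: Rle_trans (line_remainder (F n) (D n) A x y eta (HF n) _) _.
  move=> t i j ht; set z := vline _ _ _.
  have hz : nsq z <= r * r by exact: nsq_vline_le.
  have h1 : Rabs (D n z i j - D n (vzero d) i j) <= eta / 2.
    apply: Hd; first nra; first by rewrite nsq_zero; lra.
    have -> : vsub z (vzero d) = z.
      by apply: functional_extensionality => l; rewrite /vsub /vzero; ring.
    have := nsq_le_vnorm z r ltac:(lra) hz; lra.
  have := HN n i j hn; have := Rabs_triang (D n z i j - D n (vzero d) i j) (D n (vzero d) i j - A i j).
  have -> : D n z i j - D n (vzero d) i j + (D n (vzero d) i j - A i j) = D n z i j - A i j by ring.
  lra.
apply: Rmult_le_compat_r; first exact: nsq_ge0.
have : c = e2 * (INR d * INR d + 1) by rewrite /e2; field; nra.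
rewrite eta2; nra.
Qed.

(** * The metric and compactness in l^2 *)

Lemma psumE {d} (x : Seq d) N :
  psum x N = sum_f_R0 (fun k => nsq (x (Z.of_nat k - Z.of_nat N)%Z)) (2 * N)%N.
Proof. by []. Qed.

Lemma psum0 {d} (x : Seq d) : psum x 0 = nsq (x 0%Z).
Proof. by []. Qed.

Lemma psumS {d} (x : Seq d) N :
  psum x N.+1 = psum x N + nsq (x (Z.of_nat N + 1)%Z) + nsq (x (- (Z.of_nat N + 1))%Z).
Proof.
rewrite !psumE mulnS add2n tech5 decomp_sum; last lia.
rewrite [Nat.pred _]/=.
rewrite (PartSum.sum_eq _ (fun k => nsq (x (Z.of_nat k - Z.of_nat N)%Z))); last first.
  by move=> i _; congr (nsq (x _)); lia.
have -> : (Z.of_nat (2 * N).+2 - Z.of_nat N.+1 = Z.of_nat N + 1)%Z.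
  by rewrite -multE; lia.
have -> : (Z.of_nat 0 - Z.of_nat N.+1 = - (Z.of_nat N + 1))%Z by lia.
lra.
Qed.

Lemma psum_ge0 {d} (x : Seq d) N : 0 <= psum x N.
Proof.
elim: N => [|N IH]; first by rewrite psum0; exact: nsq_ge0.
rewrite psumS; have := nsq_ge0 (x (Z.of_nat N + 1)%Z); have := nsq_ge0 (x (- (Z.of_nat N + 1))%Z); lra.
Qed.

(** Outside the central window the sum splits into two one-sided rays, the form in which the two
    ends are estimated separately. *)
Lemma psum_add {d} (x : Seq d) N L :
  psum x (N + L)%coq_nat = psum x N + @rsum L (fun j => nsq (x (Z.of_nat (N.+1 + j)%coq_nat)))
    + @rsum L (fun j => nsq (x (- Z.of_nat (N.+1 + j)%coq_nat)%Z)).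
Proof.
elim: L => [|L IH]; first by rewrite Nat.add_0_r !rsum0; lra.
rewrite Nat.add_succ_r psumS IH (rsum_recr L (fun j => nsq (x (Z.of_nat (N.+1 + j)%coq_nat)))).
rewrite (rsum_recr L (fun j => nsq (x (- Z.of_nat (N.+1 + j)%coq_nat)%Z))).
have -> : (Z.of_nat (N + L)%coq_nat + 1 = Z.of_nat (N.+1 + L)%coq_nat)%Z by lia.
lra.
Qed.

Lemma psum_mono {d} (x : Seq d) N N' : (N <= N')%coq_nat -> psum x N <= psum x N'.
Proof.
move=> h; have -> : N' = Nat.add N (Nat.sub N' N) by lia.
rewrite psum_add.
have : 0 <= @rsum (N' - N)%coq_nat (fun j => nsq (x (Z.of_nat (N.+1 + j)%coq_nat))).
  by apply: rsum_ge0 => j; exact: nsq_ge0.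
have : 0 <= @rsum (N' - N)%coq_nat (fun j => nsq (x (- Z.of_nat (N.+1 + j)%coq_nat)%Z)).
  by apply: rsum_ge0 => j; exact: nsq_ge0.
lra.
Qed.

Definition l2_sq_le {d} (x : Seq d) (b : R) : Prop := forall N, psum x N <= b.

Lemma l2_sq_le_nsq {d} (x : Seq d) b n : l2_sq_le x b -> nsq (x n) <= b.
Proof.
move=> /(_ (Z.abs_nat n)) h; apply: Rle_trans h.
case E : (Z.abs_nat n) => [|N].
  rewrite psum0; have -> : n = 0%Z by lia.
  exact: Rle_refl.
rewrite psumS; have := psum_ge0 x N.
have := nsq_ge0 (x (Z.of_nat N + 1)%Z); have := nsq_ge0 (x (- (Z.of_nat N + 1))%Z).
have [->|->] : n = (Z.of_nat N + 1)%Z \/ n = (- (Z.of_nat N + 1))%Z by lia.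
- lra.
- lra.
Qed.

Lemma l2_sq_le_ray {d} (x : Seq d) b (sg : Z) (N L : nat) : sg = 1%Z \/ sg = (-1)%Z -> l2_sq_le x b ->
  @rsum L (fun j => nsq (x (sg * Z.of_nat (N.+1 + j)%coq_nat)%Z)) <= b.
Proof.
move=> hs /(_ (N + L)%coq_nat); rewrite psum_add; have := psum_ge0 x N.
have P (e : nat -> Z) : 0 <= @rsum L (fun j => nsq (x (e j))).
  by apply: rsum_ge0 => j; exact: nsq_ge0.
have := P (fun j => Z.of_nat (N.+1 + j)%coq_nat); have := P (fun j => (- Z.of_nat (N.+1 + j)%coq_nat)%Z).
case: hs => ->.
- rewrite (eq_rsum (fun j : 'I_L => nsq (x (1 * Z.of_nat (N.+1 + j)%coq_nat)%Z)) (fun j => nsq (x (Z.of_nat (N.+1 + j)%coq_nat)))); first lra.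
  by move=> j; congr (nsq (x _)); lia.
- rewrite (eq_rsum (fun j : 'I_L => nsq (x (-1 * Z.of_nat (N.+1 + j)%coq_nat)%Z)) (fun j => nsq (x (- Z.of_nat (N.+1 + j)%coq_nat)%Z))); first lra.
  by move=> j; congr (nsq (x _)); lia.
Qed.

Lemma psum_comb_le {d} (x y z : Seq d) (a b : R) N :
  (forall n, nsq (x n) <= a * nsq (y n) + b * nsq (z n)) -> psum x N <= a * psum y N + b * psum z N.
Proof.
move=> H; elim: N => [|N IH]; first by rewrite !psum0.
rewrite !psumS; have := H (Z.of_nat N + 1)%Z; have := H (- (Z.of_nat N + 1))%Z; lra.
Qed.

Lemma eq_psum {d} (x y : Seq d) N : (forall n, nsq (x n) = nsq (y n)) -> psum x N = psum y N.
Proof. by move=> H; elim: N => [|N IH]; rewrite ?psum0 ?psumS ?IH !H. Qed.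

Lemma psum_shift1 {d} (x : Seq d) N :
  psum (fun n => x (n + 1)%Z) N = psum x N + nsq (x (Z.of_nat N + 1)%Z) - nsq (x (- Z.of_nat N)%Z).
Proof.
elim: N => [|N IH]; first by rewrite !psum0 /=; lra.
rewrite !psumS IH.
have -> : (- (Z.of_nat N + 1) + 1 = - Z.of_nat N)%Z by lia.
have -> : (- Z.of_nat N.+1 = - (Z.of_nat N + 1))%Z by lia.
have -> : (Z.of_nat N.+1 + 1 = Z.of_nat N + 1 + 1)%Z by lia.
lra.
Qed.

Lemma psum_shiftN1 {d} (x : Seq d) N :
  psum (fun n => x (n - 1)%Z) N = psum x N + nsq (x (- (Z.of_nat N + 1))%Z) - nsq (x (Z.of_nat N)).
Proof.
elim: N => [|N IH]; first by rewrite !psum0 /=; lra.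
rewrite !psumS IH.
have -> : (Z.of_nat N + 1 - 1 = Z.of_nat N)%Z by lia.
have -> : (- (Z.of_nat N + 1) - 1 = - (Z.of_nat N.+1 + 1))%Z by lia.
have -> : (Z.of_nat N.+1 = Z.of_nat N + 1)%Z by lia.
lra.
Qed.

(** A unit shift moves a symmetric window into the next larger one, so a bound valid for all windows
    survives it. *)
Lemma l2_sq_le_shift {d} (x : Seq d) b m : l2_sq_le x b -> l2_sq_le (fun n => x (n + m)%Z) b.
Proof.
move=> H; elim/Z.peano_ind: m => [|m IH|m IH] N.
- by rewrite (eq_psum _ x) // => n; rewrite Z.add_0_r.
- rewrite (eq_psum _ (fun n => x (n + 1 + m)%Z)); last by move=> n; congr (nsq (x _)); lia.
  rewrite (psum_shift1 (fun n => x (n + m)%Z)).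
  have := IH N.+1; rewrite psumS.
  have := nsq_ge0 (x (- Z.of_nat N + m)%Z); have := nsq_ge0 (x (- (Z.of_nat N + 1) + m)%Z); lra.
- rewrite (eq_psum _ (fun n => x (n - 1 + m)%Z)); last by move=> n; congr (nsq (x _)); lia.
  rewrite (psum_shiftN1 (fun n => x (n + m)%Z)).
  have := IH N.+1; rewrite psumS.
  have := nsq_ge0 (x (Z.of_nat N + m)%Z); have := nsq_ge0 (x ((Z.of_nat N + 1) + m)%Z); lra.
Qed.

Definition seq_sub {d} (x y : Seq d) : Seq d := fun n => vsub (x n) (y n).

Lemma nsq_vsub_sym {d} (u v : Rd d) : nsq (vsub u v) = nsq (vsub v u).
Proof. by apply: eq_rsum => i; rewrite /vsub; ring. Qed.

Lemma nsq_vsub0 {d} (u : Rd d) : nsq (vsub u (vzero d)) = nsq u.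
Proof. by apply: eq_rsum => i; rewrite /vsub /vzero; ring. Qed.

Lemma dist_le_zero {d} (x : Seq d) r : dist_le x (fun _ => vzero d) r <-> 0 <= r /\ l2_sq_le x (r * r).
Proof.
by split; case=> r0 H; split => // N; have := H N; rewrite (eq_psum _ x) // => n; exact: nsq_vsub0.
Qed.

Lemma in_l2_iff {d} (x : Seq d) : in_l2 x <-> exists b, l2_sq_le x b.
Proof.
split; first by case=> r /dist_le_zero [_ H]; exists (r * r).
case=> b H; exists (sqrt b); apply/dist_le_zero; split; first exact: sqrt_pos.
have := Rle_trans _ _ _ (psum_ge0 x 0) (H 0%N) => b0.
by rewrite sqrt_sqrt.
Qed.

(** The radius below [r] in [dist_lt] may be [0]; a midpoint makes it positive, so that the triangle
    inequality can divide by it. *)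
Lemma dist_lt_iff {d} (x y : Seq d) r :
  dist_lt x y r <-> exists q, 0 < q /\ q < r /\ l2_sq_le (seq_sub x y) (q * q).
Proof.
split.
- case=> q [qr [q0 H]].
  exists ((q + r) / 2); split; first lra; split; first lra.
  by move=> N; apply: Rle_trans (H N) _; nra.
- by case=> q [q0 [qr H]]; exists q; split => //; split => //; lra.
Qed.

Lemma dist_lt_sym {d} (x y : Seq d) r : dist_lt x y r -> dist_lt y x r.
Proof.
move=> /dist_lt_iff [q [q0 [qr H]]]; apply/dist_lt_iff; exists q; split => //; split => // N.
by rewrite (eq_psum _ (seq_sub x y)) // => n; exact: nsq_vsub_sym.
Qed.

Lemma dist_lt_refl {d} (x : Seq d) r : 0 < r -> dist_lt x x r.
Proof.
move=> r0; apply/dist_lt_iff; exists (r / 2); split; first lra; split; first lra.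
have Z n : nsq (seq_sub x x n) = 0.
  by rewrite (eq_nsq _ (vzero d)) ?nsq_zero // => i; rewrite /seq_sub /vsub /vzero; ring.
elim=> [|N IH]; rewrite ?psum0 ?psumS !Z; nra.
Qed.

Lemma dist_lt_triangle {d} (x y z : Seq d) r s : dist_lt x y r -> dist_lt y z s -> dist_lt x z (r + s).
Proof.
move=> /dist_lt_iff [p [p0 [pr Hp]]] /dist_lt_iff [q [q0 [qs Hq]]]; apply/dist_lt_iff.
exists (p + q); split; first lra; split; first lra.
move=> N.
(* This is the optimal Young parameter: it turns the bound into exactly [(p + q)^2]. *)
have t0 : 0 < q / p by apply: Rdiv_lt_0_compat.
have := psum_comb_le (seq_sub x z) (seq_sub x y) (seq_sub y z) (1 + q / p) (1 + / (q / p)) N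
  (fun n => nsq_young (q / p) (seq_sub x y n) (seq_sub y z n) (seq_sub x z n) t0 (fun i => ltac:(rewrite /seq_sub /vsub; ring))).
have i0 := Rinv_0_lt_compat _ t0.
have h1 : (1 + q / p) * psum (seq_sub x y) N <= (1 + q / p) * (p * p).
  by apply: Rmult_le_compat_l; [lra|exact: Hp].
have h2 : (1 + / (q / p)) * psum (seq_sub y z) N <= (1 + / (q / p)) * (q * q).
  by apply: Rmult_le_compat_l; [lra|exact: Hq].
have -> : (p + q) * (p + q) = (1 + q / p) * (p * p) + (1 + / (q / p)) * (q * q) by field; lra.
lra.
Qed.

Section UltraCompactness.
Context {U : (nat -> Prop) -> Prop} (HU : nonprincipal_ultrafilter U).

Definition seq_ulim {d} (x : nat -> Seq d) (x0 : Seq d) : Prop :=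
  forall r, 0 < r -> U (fun k => dist_lt (x k) x0 r).

(** If no point of [K] were a limit, each would have a ball that [y k] avoids for [U]-almost all
    [k]; finitely many such balls cover [K], so some [y k] would avoid all of [K]. *)
Lemma compact_seq_ulim {d} (K : Seq d -> Prop) (y : nat -> Seq d) :
  compact_l2 K -> (forall k, K (y k)) -> exists y0, K y0 /\ seq_ulim y y0.
Proof.
move=> [Kl2 Kc] Hy; apply: NNPP => Hn.
(* Every pair serves as an index: a ball that [y] visits [U]-often is replaced by the empty set,
   which is open too. *)
pose V (p : Seq d * R) (z : Seq d) := dist_lt p.1 z p.2 /\ ~ U (fun k => dist_lt (y k) p.1 p.2).
have [|x Kx|l Hl] := Kc (Seq d * R)%type V.
- move=> [x r] z _ [/= /dist_lt_iff [q [q0 [qr Hq]]] nU].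
  exists ((r - q) / 2); split; first lra.
  move=> w _ zw; split => //=.
  have xz : dist_lt x z ((r + q) / 2) by apply/dist_lt_iff; exists q; split => //; split => //; lra.
  have := dist_lt_triangle _ _ _ _ _ xz zw.
  by have -> : (r + q) / 2 + (r - q) / 2 = r by lra.
- have [r [r0 nU]] : exists r, 0 < r /\ ~ U (fun k => dist_lt (y k) x r).
    apply: NNPP => H; apply: Hn; exists x; split => // r r0.
    by apply: NNPP => nU; apply: H; exists r.
  by exists (x, r); split => //; exact: dist_lt_refl.
- have Hall : U (fun k => forall p, In p l -> ~ V p (y k)).
    apply: (ultra_finite_all HU l (fun p k => ~ V p (y k))) => p.
    case: (classic (U (fun k => dist_lt (y k) p.1 p.2))) => hU.
      by apply: ultra_all => // k [].
    apply: (ultra_mono HU _ _ (ultra_not HU _ hU)) => k nk [h _]; apply: nk.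
    exact: dist_lt_sym.
  have [k Hk] := ultra_ex HU _ Hall.
  have [p [pl Vp]] := Hl (y k) (Hy k).
  exact: Hk pl Vp.
Qed.

(** Lebesgue number: failure at every scale [/ INR k.+1] gives bad centres [x k], and a ball around
    their limit inside one [V i] swallows the small balls around nearby centres. *)
Lemma seq_ulim_lebesgue {d} (D : Seq d -> Prop) (I : Type) (V : I -> Seq d -> Prop) :
  (forall x, D x -> in_l2 x) ->
  (forall x : nat -> Seq d, (forall k, D (x k)) -> exists x0, D x0 /\ seq_ulim x x0) ->
  (forall i, open_l2 (V i)) -> (forall x, D x -> exists i, V i x) ->
  exists r, 0 < r /\ forall x, D x -> exists i, forall y, D y -> dist_lt x y r -> V i y.
Proof.
move=> Dl2 Hlim Vo Vc; apply: NNPP => Hn.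
have /(_ _)/constructive_indefinite_description E (k : nat) :
    exists x, D x /\ forall i, exists y, D y /\ dist_lt x y (/ INR k.+1) /\ ~ V i y.
  apply: NNPP => H; apply: Hn; exists (/ INR k.+1); split.
    by apply: Rinv_0_lt_compat; apply: lt_0_INR; lia.
  move=> x Dx; apply: NNPP => H2; apply: H; exists x; split => // i.
  apply: NNPP => H3; apply: H2; exists i => y Dy xy; apply: NNPP => nV; apply: H3.
  by exists y.
pose x k := proj1_sig (E k).
have Hx k : D (x k) /\ forall i, exists y, D y /\ dist_lt (x k) y (/ INR k.+1) /\ ~ V i y
  := proj2_sig (E k).
have [x0 [Dx0 lx0]] := Hlim x (fun k => proj1 (Hx k)).
have [i Vi] := Vc x0 Dx0.
have [r [r0 Hr]] := Vo i x0 (Dl2 _ Dx0) Vi.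
have [N HN] := INR_unbounded (/ (r / 2)).
have [k [hk Nk]] := ultra_ex HU _ (ultra_and HU _ _ (lx0 (r / 2) ltac:(lra)) (ultra_tail HU N)).
have [_ /(_ i) [y [Dy [xy nV]]]] := Hx k.
apply: nV; apply: Hr; first exact: Dl2.
have i0 : 0 < / (r / 2) by apply: Rinv_0_lt_compat; lra.
have : / INR k.+1 < r / 2.
  rewrite -(Rinv_inv (r / 2)); apply: Rinv_lt_contravar.
    by apply: Rmult_lt_0_compat => //; apply: lt_0_INR; lia.
  rewrite S_INR; have := le_INR _ _ Nk; lra.
have := dist_lt_triangle _ _ _ _ _ (dist_lt_sym _ _ _ hk) xy => /dist_lt_iff [q [q0 [qr Hq]]] hr.
by apply/dist_lt_iff; exists q; split => //; split => //; lra.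
Qed.

Lemma seq_ulim_totally_bounded {d} (D : Seq d -> Prop) :
  (forall x : nat -> Seq d, (forall k, D (x k)) -> exists x0, D x0 /\ seq_ulim x x0) ->
  forall r, 0 < r -> exists l, (forall p, In p l -> D p) /\
    forall x, D x -> exists p, In p l /\ dist_lt p x r.
Proof.
move=> Hlim r r0; apply: NNPP => Hn.
have /(_ _)/constructive_indefinite_description E (l : list (Seq d)) :
    exists x, (forall p, In p l -> D p) -> D x /\ forall p, In p l -> ~ dist_lt p x r.
  (* For a list that leaves [D] the claim is vacuous, and the zero sequence is a mere default. *)
  case: (classic (forall p, In p l -> D p)) => Dl; last by exists (fun _ => vzero d).
  have [x Hx] : exists x, ~ (D x -> exists p, In p l /\ dist_lt p x r).
    apply: NNPP => H; apply: Hn; exists l; split => // x.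
    by apply: NNPP => H2; apply: H; exists x.
  exists x => _; split; first by apply: NNPP => nD; apply: Hx.
  by move=> p pl px; apply: Hx => _; exists p.
pose c l := proj1_sig (E l).
have Hc l : (forall p, In p l -> D p) -> D (c l) /\ forall p, In p l -> ~ dist_lt p (c l) r
  := proj2_sig (E l).
(* Greedy choice: each new point is not within [r] of any earlier one, whereas a limit along [U]
   brings two of them that close. *)
pose s := fix s (n : nat) : list (Seq d) := if n is m.+1 then c (s m) :: s m else nil.
have Ds n p : In p (s n) -> D p.
  by elim: n p => [|n IH] p //= [<-|/IH //]; apply: (proj1 (Hc _ IH)).
have sub m n : (m < n)%coq_nat -> In (c (s m)) (s n).
  elim: n => [|n IH] h; first lia.
  by case: (Nat.eq_dec m n) => [->|ne]; [left|right; apply: IH; lia].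
have [x0 [_ lx0]] := Hlim (fun n => c (s n)) (fun n => proj1 (Hc _ (Ds n))).
have h := lx0 (r / 2) ltac:(lra).
have [k1 h1] := ultra_ex HU _ h.
have [k2 [h2 k12]] := ultra_ex HU _ (ultra_and HU _ _ h (ultra_tail HU k1.+1)).
apply: (proj2 (Hc _ (Ds k2)) _ (sub k1 k2 k12)).
have := dist_lt_triangle _ _ _ _ _ h1 (dist_lt_sym _ _ _ h2).
by have -> : r / 2 + r / 2 = r by lra.
Qed.

(** One fixed ultrafilter suffices to test compactness: it gives a Lebesgue number of the cover, and
    a finite net at that scale selects the subcover. *)
Lemma compact_of_seq_ulim {d} (D : Seq d -> Prop) :
  (forall x, D x -> in_l2 x) ->
  (forall x : nat -> Seq d, (forall k, D (x k)) -> exists x0, D x0 /\ seq_ulim x x0) ->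
  compact_l2 D.
Proof.
move=> Dl2 Hlim; split => // I V Vo Vc.
have [r [r0 Hr]] := seq_ulim_lebesgue D I V Dl2 Hlim Vo Vc.
have [l [Dl Hl]] := seq_ulim_totally_bounded D Hlim r r0.
have [ix Hix] : exists ix : list I, forall p, In p l -> exists i, In i ix /\
    forall y, D y -> dist_lt p y r -> V i y.
  elim: l Dl {Hl} => [|p l IH] Dl; first by exists nil.
  have [js Hjs] := IH (fun q h => Dl q (or_intror h)).
  have [i Hi] := Hr p (Dl p (or_introl erefl)).
  exists (i :: js) => q [<-|/Hjs [j [jjs Hj]]]; first by exists i; split => //; left.
  by exists j; split => //; right.
exists ix => x Dx; have [p [pl px]] := Hl x Dx.
by have [i [iix Hi]] := Hix p pl; exists i; split => //; apply: Hi.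
Qed.

End UltraCompactness.

(** * Behaviour of bounded sequences at the two ends *)

Lemma l2_sq_le_tail {d} (x : Seq d) b e : l2_sq_le x b -> 0 < e ->
  exists N : nat, forall n, (Z.of_nat N < Z.abs n)%Z -> nsq (x n) <= e.
Proof.
move=> Hb e0; pose E s := exists N, s = psum x N.
have [|| s [ub lub]] := completeness E.
- by exists b => s [N ->].
- by exists (psum x 0); exists 0%N.
have [N HN] : exists N, s - e < psum x N.
  apply: NNPP => H; have : s <= s - e; last lra.
  by apply: lub => t [N ->]; apply: Rnot_lt_le => h; apply: H; exists N.
exists N => n hn.
have [M hM] : exists M, Z.abs_nat n = M.+1 by exists (Z.abs_nat n).-1; lia.
have NM : (N <= M)%coq_nat by lia.
have := psum_mono x N M NM; have := ub (psum x M.+1) (ex_intro _ _ erefl); rewrite psumS.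
have := nsq_ge0 (x (Z.of_nat M + 1)%Z); have := nsq_ge0 (x (- (Z.of_nat M + 1))%Z).
have [->|->] : n = (Z.of_nat M + 1)%Z \/ n = (- (Z.of_nat M + 1))%Z by lia.
- lra.
- lra.
Qed.

Lemma inv_INR_lt (e : R) : 0 < e -> exists N, forall n, (N <= n)%coq_nat -> / INR n.+1 < e.
Proof.
move=> e0; have [N HN] := INR_unbounded (/ e); exists N => n /le_INR hn.
have i0 := Rinv_0_lt_compat _ e0.
rewrite -(Rinv_inv e); apply: Rinv_lt_contravar; rewrite S_INR; last lra.
by apply: Rmult_lt_0_compat => //; lra.
Qed.

Lemma ulim_psum {U : (nat -> Prop) -> Prop} (HU : nonprincipal_ultrafilter U) {d}
  (x : nat -> Seq d) (x0 : Seq d) N :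
  (forall n, vulim (U := U) (fun k => x k n) (x0 n)) ->
  ulim (U := U) (fun k => psum (x k) N) (psum x0 N).
Proof.
move=> H; elim: N => [|N IH].
  exact: (ulim_nsq HU (fun k => x k 0%Z)).
rewrite psumS.
have -> : (fun k => psum (x k) N.+1) = (fun k => psum (x k) N + nsq (x k (Z.of_nat N + 1)%Z)
    + nsq (x k (- (Z.of_nat N + 1))%Z)).
  by apply: functional_extensionality => k; rewrite psumS.
apply: (ulim_add HU); last exact: (ulim_nsq HU (fun k => x k _)).
by apply: (ulim_add HU) => //; exact: (ulim_nsq HU (fun k => x k _)).
Qed.

Lemma nsq_seq_sub_le {d} (x y : Seq d) n : nsq (seq_sub x y n) <= 2 * nsq (x n) + 2 * nsq (y n).
Proof.
have N : nsq (fun i => (-1) * y n i) = nsq (y n) by rewrite nsq_scal; lra.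
rewrite -N; apply: nsq_add_le => i; rewrite /seq_sub /vsub; ring.
Qed.

(** This is [Gmap] with the parameter on the circle frozen, since properness is claimed for each
    parameter separately. *)
Definition residual {d} (F : Z -> Rd d -> Rd d) (x : Seq d) : Seq d :=
  fun n => vsub (x (n + 1)%Z) (F n (x n)).

Lemma residual_l2 {d} (F : Z -> Rd d -> Rd d) (x : Seq d) :
  uniformly_lipschitz_on_balls F -> (forall n, F n (vzero d) = vzero d) -> in_l2 x ->
  in_l2 (residual F x).
Proof.
move=> HL F0 /in_l2_iff [b Hb].
have b0 : 0 <= b by apply: Rle_trans (psum_ge0 x 0) (Hb 0%N).
(* [b] bounds squared norms, and [(b + 1)^2 >= b] makes [b + 1] an admissible radius. *)
have [L [L0 H]] := HL (b + 1) ltac:(lra).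
apply/in_l2_iff; exists (2 * b + 2 * L * b) => N.
apply: Rle_trans (psum_comb_le _ (fun n => x (n + 1)%Z) x 2 (2 * L) N _) _.
  move=> n; apply: Rle_trans (nsq_seq_sub_le (fun n => x (n + 1)%Z) (fun n => F n (x n)) n) _.
  have z0 : nsq (vzero d) <= (b + 1) * (b + 1) by rewrite nsq_zero; nra.
  have xn : nsq (x n) <= (b + 1) * (b + 1) by have := l2_sq_le_nsq x b n Hb; nra.
  have := H n _ _ z0 xn; rewrite F0 !nsq_vsub0; lra.
have h1 := l2_sq_le_shift x b 1 Hb N; have h2 := Hb N.
have : 2 * L * psum x N <= 2 * L * b by apply: Rmult_le_compat_l; lra.
lra.
Qed.

Section AlongUltrafilter.
Context {U : (nat -> Prop) -> Prop} (HU : nonprincipal_ultrafilter U).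

Lemma seq_ulim_coord {d} (x : nat -> Seq d) (x0 : Seq d) n :
  seq_ulim (U := U) x x0 -> vulim (U := U) (fun k => x k n) (x0 n).
Proof.
move=> H; apply: (vulim_of_nsq HU) => e e0.
have r0 := sqrt_lt_R0 _ e0.
apply: (ultra_mono HU _ _ (H _ r0)) => k /dist_lt_iff [q [q0 [qr Hq]]].
have := l2_sq_le_nsq _ _ n Hq; rewrite /seq_sub => h; apply: (Rle_lt_trans _ _ _ h).
have := sqrt_sqrt e ltac:(lra); nra.
Qed.

(* If mass of size [e] survived arbitrarily far out, then translating it back to the origin and
   passing to the limit would produce a nonzero solution of the limit equation in l^2. *)
Lemma no_escaping_mass {d} (F : Z -> Rd d -> Rd d) (g : Rd d -> Rd d) (sg : Z)
  (x : nat -> Seq d) (y0 : Seq d) (b : R) :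
  sg = 1%Z \/ sg = (-1)%Z ->
  uniformly_lipschitz_on_balls F ->
  (forall M eps, 0 < eps -> exists N, forall n u, (N <= sg * n)%Z -> nsq u <= M * M ->
     nsq (vsub (F n u) (g u)) < eps) ->
  (forall z : Seq d, in_l2 z -> (forall n, z (n + 1)%Z = g (z n)) -> forall n, z n = vzero d) ->
  0 < b -> (forall k, l2_sq_le (x k) (b * b)) -> in_l2 y0 ->
  seq_ulim (U := U) (fun k => residual F (x k)) y0 ->
  forall e, 0 < e -> exists N, U (fun k => forall n, (N <= sg * n)%Z -> nsq (x k n) <= e).
Proof.
move=> hsg HL Hg Hno b0 Hx /in_l2_iff [by0 Hy0] Hy e e0; apply: NNPP => Hn.
have E0 (N : nat) : exists p : nat * Z, (Z.of_nat N <= sg * p.2)%Z /\ e < nsq (x p.1 p.2) /\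
    dist_lt (residual F (x p.1)) y0 (/ INR N.+1).
  have i0 : 0 < / INR N.+1 by apply: Rinv_0_lt_compat; apply: lt_0_INR; lia.
  have nU : U (fun k => ~ (forall n, (Z.of_nat N <= sg * n)%Z -> nsq (x k n) <= e)).
    by apply: (ultra_not HU) => h; apply: Hn; exists (Z.of_nat N).
  have [k [h1 h2]] := ultra_ex HU _ (ultra_and HU _ _ nU (Hy _ i0)).
  apply: NNPP => H; apply: h1 => n hn; apply: Rnot_lt_le => h; apply: H.
  by exists (k, n).
have E N := constructive_indefinite_description _ (E0 N).
pose kk N := (proj1_sig (E N)).1; pose nn N := (proj1_sig (E N)).2.
have HE N : (Z.of_nat N <= sg * nn N)%Z /\ e < nsq (x (kk N) (nn N)) /\
    dist_lt (residual F (x (kk N))) y0 (/ INR N.+1) := proj2_sig (E N).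
pose Zs N : Seq d := fun m => x (kk N) (m + nn N)%Z.
have HZ N : l2_sq_le (Zs N) (b * b) by apply: l2_sq_le_shift.
(* From here on [U] acts on the index [N] of the extracted translates, no longer on the original
   [k]. *)
have /(_ _)/constructive_indefinite_description Lz m : exists l, vulim (U := U) (fun N => Zs N m) l.
  by apply: (vulim_exists HU _ b) => [|N]; [lra|apply: l2_sq_le_nsq].
pose z : Seq d := fun m => proj1_sig (Lz m).
have Hz m : vulim (U := U) (fun N => Zs N m) (z m) := proj2_sig (Lz m).
have z2 : l2_sq_le z (b * b).
  move=> N; apply: (ulim_le HU _ _ _ (ulim_psum HU Zs z N Hz)).
  by apply: (ultra_all HU) => k; exact: HZ.
have zl2 : in_l2 z by apply/in_l2_iff; exists (b * b).
have zeq m : z (m + 1)%Z = g (z m).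
  apply: functional_extensionality => i.
  apply: (ulim_unique HU (fun N => Zs N (m + 1)%Z i)); first exact: Hz.
  move: i; apply: (vulim_of_nsq HU (fun N => Zs N (m + 1)%Z)) => eps eps0.
  have [L [L0 HLb]] := HL b b0.
  (* Four errors of size [eps / 16] are combined by two levels of [nsq_add_le], each level costing a
     factor [4] at equal sizes. *)
  have eL : 0 < eps / (16 * L) by apply: Rdiv_lt_0_compat; lra.
  have U1 := vulim_nsq_lt HU _ _ _ (Hz m) eL.
  have e16 : 0 < eps / 16 by lra.
  have [N2 H2] := Hg b _ e16.
  (* A distance [q] below both [1] and [eps / 16] also has [q^2 < eps / 16]. *)
  have [N3 H3] := inv_INR_lt _ (Rmin_glb_lt _ _ _ Rlt_0_1 e16).
  have [N4 H4] := l2_sq_le_tail y0 by0 _ Hy0 e16.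
  (* The summand [Z.abs_nat m] offsets the translation, so that [m + nn N] still lies beyond [N2]
     and [N4]. *)
  have U2 := ultra_tail HU (Nat.add (Z.abs_nat N2) (Nat.add N3 (Nat.add N4 (Z.abs_nat m)).+1)).
  apply: (ultra_mono HU _ _ (ultra_and HU _ _ U1 U2)) => N [h1 h2].
  have [hn [_ hd]] := HE N.
  pose n := (m + nn N)%Z.
  have a1 : nsq (vsub (F n (Zs N m)) (F n (z m))) < eps / 16.
    have := HLb n (z m) (Zs N m) (l2_sq_le_nsq _ _ _ z2) (l2_sq_le_nsq _ _ _ (HZ N)).
    have : L * nsq (vsub (Zs N m) (z m)) < L * (eps / (16 * L)) by apply: Rmult_lt_compat_l.
    have -> : L * (eps / (16 * L)) = eps / 16 by field; lra.
    lra.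
  have a2 : nsq (vsub (F n (z m)) (g (z m))) < eps / 16.
    by apply: H2; [rewrite /n; lia|exact: l2_sq_le_nsq].
  have a3 : nsq (seq_sub (residual F (x (kk N))) y0 n) < eps / 16.
    have [q [q0 [q1 Hq]]] := proj1 (dist_lt_iff _ _ _) hd.
    have := l2_sq_le_nsq _ _ n Hq.
    have := H3 N ltac:(lia); have := Rmin_l 1 (eps / 16); have := Rmin_r 1 (eps / 16).
    nra.
  have a4 : nsq (y0 n) <= eps / 16 by apply: H4; rewrite /n; lia.
  have b1 := nsq_add_le (vsub (F n (Zs N m)) (F n (z m))) (vsub (F n (z m)) (g (z m)))
    (vsub (F n (Zs N m)) (g (z m))) (fun i => ltac:(rewrite /vsub; ring)).
  have b2 := nsq_add_le (seq_sub (residual F (x (kk N))) y0 n) (y0 n)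
    (residual F (x (kk N)) n) (fun i => ltac:(rewrite /seq_sub /vsub; ring)).
  have b3 := nsq_add_le (vsub (F n (Zs N m)) (g (z m))) (residual F (x (kk N)) n)
    (vsub (Zs N (m + 1)%Z) (g (z m))).
  have {}b3 := b3 (fun i => ltac:(rewrite /residual /vsub /Zs /n;
     replace (m + nn N + 1)%Z with (m + 1 + nn N)%Z by lia; ring)).
  lra.
(* The contradiction sits at the origin, where every translate has squared norm above [e] and the
   limit is [0]. *)
have z0 := Hno z zl2 zeq 0%Z.
have [N HN] := ultra_ex HU _ (vulim_nsq_lt HU _ _ _ (Hz 0%Z) e0).
have [_ [hN _]] := HE N.
move: HN; rewrite z0 nsq_vsub0 /Zs Z.add_0_l; lra.
Qed.

(* Once the orbits are uniformly small far out, the nonlinear recurrence is a small perturbation of the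
   hyperbolic linear one, so the energy estimate controls the difference by the residuals and
   the two end terms; the outer one disappears along a suitable sequence of lengths. *)
Lemma small_ray_energy {d} (F : Z -> Rd d -> Rd d) (A : Mat d) (sg : Z)
  (x : nat -> Seq d) (x0 : Seq d) (b : R) :
  sg = 1%Z \/ sg = (-1)%Z ->
  hyperbolic A ->
  (forall c, 0 < c -> exists rho N, 0 < rho /\ forall n u v, (N <= sg * n)%Z ->
    nsq u <= rho -> nsq v <= rho ->
    nsq (fun i => F n v i - F n u i - mv A (vsub v u) i) <= c * nsq (vsub v u)) ->
  (forall k, l2_sq_le (x k) b) -> l2_sq_le x0 b ->
  (forall n, vulim (U := U) (fun k => x k n) (x0 n)) ->
  seq_ulim (U := U) (fun k => residual F (x k)) (residual F x0) ->
  (forall e, 0 < e -> exists N, U (fun k => forall n, (N <= sg * n)%Z -> nsq (x k n) <= e)) ->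
  forall e, 0 < e -> exists N0, forall N, (N0 <= N)%coq_nat ->
    U (fun k => forall L,
       @rsum L (fun j => nsq (seq_sub (x k) x0 (sg * Z.of_nat (N.+1 + j)%coq_nat)%Z)) <= e).
Proof.
move=> hsg HA Hrem Hx Hx0 Hlim Hres Htail e e0.
have [K [c [K0 [c0 HK]]]] := perturbed_energy_estimate A HA.
have [rho [N1 [rho0 Hrho]]] := Hrem c c0.
have [N2 HN2] := Htail rho rho0.
exists (Nat.add (Z.abs_nat N1) (Z.abs_nat N2)) => N hN.
(* Three equal shares: the residual difference, the inner end value and the outer end value. *)
have e1 : 0 < e / (3 * (K + 1)) by apply: Rdiv_lt_0_compat; lra.
set e' := e / (3 * (K + 1)) in e1.
have Ee : (K + 1) * (e' + e' + e') = e by rewrite /e'; field; lra.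
have r0 := sqrt_lt_R0 _ e1.
have U1 := Hres _ r0.
have U2 := vulim_nsq_lt HU _ _ _ (Hlim (sg * Z.of_nat N.+1)%Z) e1.
apply: (ultra_mono HU _ _ (ultra_and HU _ _ HN2 (ultra_and HU _ _ U1 U2))) => k [h1 [h2 h3]] L.
set W := seq_sub (x k) x0.
set Y := seq_sub (residual F (x k)) (residual F x0).
have small0 n : (N2 <= sg * n)%Z -> nsq (x0 n) <= rho.
  move=> hn; apply: (ulim_le HU _ _ _ (ulim_nsq HU _ _ (Hlim n))).
  by apply: (ultra_mono HU _ _ HN2) => j; apply.
have Wrec n : (Z.of_nat N < sg * n)%Z ->
    nsq (vsub (vsub (W (n + 1)%Z) (mv A (W n))) (Y n)) <= c * nsq (W n).
  move=> hn.
  have := Hrho n (x0 n) (x k n) ltac:(lia) (small0 n ltac:(lia)) (h1 n ltac:(lia)).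
  rewrite -/(W n); set u := fun i => _; rewrite (eq_nsq u (vsub (vsub (W (n + 1)%Z) (mv A (W n))) (Y n))) //.
  by move=> i; rewrite /u /vsub /Y /residual /seq_sub /vsub /W /seq_sub /vsub; ring.
pose R_ j := nsq (W (sg * Z.of_nat (N.+1 + j)%coq_nat)%Z).
pose H_ j := nsq (Y (sg * Z.of_nat (N.+1 + j)%coq_nat)%Z).
have R0 j : 0 <= R_ j by exact: nsq_ge0.
have H0 j : 0 <= H_ j by exact: nsq_ge0.
(* At the negative end the estimate controls the indices [1] to [M] instead of [0] to [M - 1]. The
   extra forcing term and the constant [K + 1] make room for this shift. *)
have est M : @rsum M (fun j => R_ j) <= (K + 1) * (@rsum M.+1 (fun j => H_ j) + R_ 0%N + R_ M).
  have h0 : 0 <= @rsum M.+1 (fun j => H_ j) by apply: rsum_ge0.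
  have P : 0 <= @rsum M.+1 (fun j => H_ j) + R_ 0%N + R_ M.
    by have := R0 0%N; have := R0 M; lra.
  case: hsg => hsg.
  - have := HK M (fun j => W (Z.of_nat (N.+1 + j)%coq_nat)) (fun j => Y (Z.of_nat (N.+1 + j)%coq_nat)).
    have ER j : nsq (W (Z.of_nat (N.+1 + j)%coq_nat)) = R_ j by rewrite /R_ hsg Z.mul_1_l.
    have EH j : nsq (Y (Z.of_nat (N.+1 + j)%coq_nat)) = H_ j by rewrite /H_ hsg Z.mul_1_l.
    rewrite !ER (eq_rsum _ (fun j : 'I_M => R_ j)); last by move=> j; exact: ER.
    rewrite (eq_rsum (fun j : 'I_M => nsq (Y _)) (fun j => H_ j)); last by move=> j; exact: EH.
    have S : @rsum M (fun j => H_ j) <= @rsum M.+1 (fun j => H_ j) by apply: rsum_mono => //; lia.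
    have S2 : K * (@rsum M (fun j => H_ j) + R_ 0%N + R_ M) <= K * (@rsum M.+1 (fun j => H_ j) + R_ 0%N + R_ M).
      by apply: Rmult_le_compat_l; lra.
    have HW n : (n < M)%coq_nat -> nsq (vsub (rdefect A (fun j => W (Z.of_nat (N.+1 + j)%coq_nat)) n)
        (Y (Z.of_nat (N.+1 + n)%coq_nat))) <= c * nsq (W (Z.of_nat (N.+1 + n)%coq_nat)).
      move=> _; have := Wrec (Z.of_nat (N.+1 + n)%coq_nat) ltac:(lia).
      have -> : (Z.of_nat (N.+1 + n)%coq_nat + 1 = Z.of_nat (N.+1 + n.+1)%coq_nat)%Z by lia.
      by [].
    by move/(_ HW); lra.
  (* The recurrence goes upward in [n], so on the negative ray it is run from the outer end towards
     the origin and the sums are reversed afterwards. *)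
  - pose s j := (Z.of_nat j - Z.of_nat (N.+1 + M)%coq_nat)%Z.
    have := HK M (fun j => W (s j)) (fun j => Y (s j)).
    have Es (j : nat) : (j < M)%coq_nat -> s j = (sg * Z.of_nat (N.+1 + (M - j.+1)%coq_nat.+1)%coq_nat)%Z.
      by move=> hj; rewrite /s hsg; lia.
    rewrite (eq_rsum _ (fun j : 'I_M => R_ (M - j.+1)%coq_nat.+1)); last first.
      by move=> j; rewrite (Es j (elimT ltP (ltn_ord j))).
    rewrite (rsum_rev M (fun j => R_ j.+1)).
    rewrite (eq_rsum (fun j : 'I_M => nsq (Y _)) (fun j : 'I_M => H_ (M - j.+1)%coq_nat.+1)); last first.
      by move=> j; rewrite (Es j (elimT ltP (ltn_ord j))).
    rewrite (rsum_rev M (fun j => H_ j.+1)).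
    have -> : nsq (W (s 0%N)) = R_ M by rewrite /R_ /s hsg; congr (nsq (W _)); lia.
    have -> : nsq (W (s M)) = R_ 0%N by rewrite /R_ /s hsg; congr (nsq (W _)); lia.
    have HW n : (n < M)%coq_nat -> nsq (vsub (rdefect A (fun j => W (s j)) n) (Y (s n))) <= c * nsq (W (s n)).
      move=> hn; have := Wrec (s n); rewrite /rdefect.
      have -> : (s n + 1 = s n.+1)%Z by rewrite /s; lia.
      by apply; rewrite hsg /s; lia.
    move/(_ HW).
    have := rsum_recl M H_; have := rsum_recl M R_; have := rsum_recr M R_; have := H0 0%N; have := R0 0%N; have := R0 M.
    set a1 := @rsum M.+1 (fun j => H_ j) in P h0 *; set a2 := @rsum M.+1 (fun j => R_ j).
    set a3 := @rsum M (fun j => R_ j); set a4 := @rsum M (fun j => R_ j.+1).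
    set a5 := @rsum M (fun j => H_ j.+1) => p1 p2 p3 p4 p5 p6 p7.
    have : K * (a5 + R_ M + R_ 0%N) <= K * (a1 + R_ 0%N + R_ M) by apply: Rmult_le_compat_l; lra.
    lra.
have [q [q0 [qr HY]]] := proj1 (dist_lt_iff _ _ _) h2.
have HYs M : @rsum M (fun j => H_ j) <= e'.
  have := l2_sq_le_ray Y _ sg N M hsg HY.
  have : q * q <= e' by have := sqrt_sqrt e' ltac:(lra); nra.
  rewrite /H_; lra.
have W2 : l2_sq_le W (2 * b + 2 * b).
  move=> M; apply: Rle_trans (psum_comb_le _ (x k) x0 2 2 M (nsq_seq_sub_le _ _)) _.
  have := Hx k M; have := Hx0 M; lra.
(* [N4] depends on [k], which is harmless: the estimate is uniform in the length, so the ray may be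
   prolonged until its outer value is small. *)
have [N4 H4] := l2_sq_le_tail W _ e' W2 e1.
have RL : R_ (Nat.add L N4.+1) <= e' by apply: H4; case: hsg => ->; lia.
have R00 : R_ 0%N < e' by rewrite /R_ Nat.add_0_r.
have := rsum_mono L (Nat.add L N4.+1) R_ R0 ltac:(lia).
have := est (Nat.add L N4.+1).
have sH := HYs (Nat.add L N4.+1).+1.
set s2 := rsum _ in sH; rewrite -/s2 => k1 k2.
have : (K + 1) * (s2 + R_ 0%N + R_ (Nat.add L N4.+1)) <= (K + 1) * (e' + e' + e').
  by apply: Rmult_le_compat_l; lra.
rewrite Ee => k3; exact: (Rle_trans _ _ _ k2 (Rle_trans _ _ _ k1 k3)).
Qed.

End AlongUltrafilter.

(** * Properness of the residual map *)

Lemma residual_coord_limit {U : (nat -> Prop) -> Prop} (HU : nonprincipal_ultrafilter U) {d}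
  (F : Z -> Rd d -> Rd d) (x : nat -> Seq d) (x0 : Seq d) b n :
  uniformly_lipschitz_on_balls F -> 0 < b ->
  (forall k, l2_sq_le (x k) (b * b)) -> l2_sq_le x0 (b * b) ->
  (forall n, vulim (U := U) (fun k => x k n) (x0 n)) ->
  vulim (U := U) (fun k => residual F (x k) n) (residual F x0 n).
Proof.
move=> HL b0 Hx Hx0 Hlim; have [L [L0 H]] := HL b b0.
apply: (vulim_of_nsq HU) => e e0.
have eL : 0 < e / (4 * L) by apply: Rdiv_lt_0_compat; lra.
have U1 := vulim_nsq_lt HU _ _ _ (Hlim n) eL.
have U2 := vulim_nsq_lt HU _ _ (e / 4) (Hlim (n + 1)%Z) ltac:(lra).
apply: (ultra_mono HU _ _ (ultra_and HU _ _ U1 U2)) => k [h1 h2].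
have a1 := H n _ _ (l2_sq_le_nsq _ _ n (Hx k)) (l2_sq_le_nsq _ _ n Hx0).
rewrite (nsq_vsub_sym (x0 n)) in a1.
have a2 : L * nsq (vsub (x k n) (x0 n)) < L * (e / (4 * L)) by apply: Rmult_lt_compat_l.
have E : L * (e / (4 * L)) = e / 4 by field; lra.
have := nsq_add_le (vsub (x k (n + 1)%Z) (x0 (n + 1)%Z)) (vsub (F n (x0 n)) (F n (x k n)))
  (vsub (residual F (x k) n) (residual F x0 n)) (fun i => ltac:(rewrite /residual /vsub; ring)).
lra.
Qed.

(* Each asymptotic end is described by a sign [sg]: [sg * n] large means that [n] is close to that end. *)
Definition regular_end {d} (F : Z -> Rd d -> Rd d) (sg : Z) : Prop :=
  (exists g : Rd d -> Rd d,
    (forall M eps, 0 < eps -> exists N, forall n u, (N <= sg * n)%Z -> nsq u <= M * M ->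
       nsq (vsub (F n u) (g u)) < eps) /\
    (forall z : Seq d, in_l2 z -> (forall n, z (n + 1)%Z = g (z n)) -> forall n, z n = vzero d)) /\
  exists A : Mat d, hyperbolic A /\
    forall c, 0 < c -> exists rho N, 0 < rho /\ forall n u v, (N <= sg * n)%Z ->
      nsq u <= rho -> nsq v <= rho ->
      nsq (fun i => F n v i - F n u i - mv A (vsub v u) i) <= c * nsq (vsub v u).

Lemma residual_proper {d} (F : Z -> Rd d -> Rd d) :
  uniformly_lipschitz_on_balls F -> regular_end F 1 -> regular_end F (-1) ->
  proper_cb (residual F).
Proof.
move=> HL Hp Hm Cs [Cl2 Ccl] [b Hb] K HK.
have [U HU] := nonprincipal_ultrafilter_exists.
apply: (compact_of_seq_ulim HU) => [x [Cx _]|x Dx]; first exact: Cl2.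
set B := Rabs b + 1; have B0 : 0 < B by rewrite /B; have := Rabs_pos b; lra.
have Hx k : l2_sq_le (x k) (B * B).
  have [b0 h] := proj1 (dist_le_zero _ _) (Hb _ (proj1 (Dx k))).
  by move=> N; apply: Rle_trans (h N) _; rewrite /B Rabs_pos_eq //; nra.
have [y0 [Ky0 Hy0]] := compact_seq_ulim HU K _ HK (fun k => proj2 (Dx k)).
have /(_ _)/constructive_indefinite_description E n : exists l, vulim (U := U) (fun k => x k n) l.
  by apply: (vulim_exists HU _ B) => [|k]; [lra|exact: l2_sq_le_nsq].
pose x0 : Seq d := fun n => proj1_sig (E n).
have Hlim n : vulim (U := U) (fun k => x k n) (x0 n) := proj2_sig (E n).
have Hx0 : l2_sq_le x0 (B * B).
  move=> N; apply: (ulim_le HU _ _ _ (ulim_psum HU x x0 N Hlim)).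
  by apply: (ultra_all HU) => k; exact: Hx.
have Ey : residual F x0 = y0.
  apply: functional_extensionality => n.
  apply: functional_extensionality => i.
  apply: (ulim_unique HU (fun k => residual F (x k) n i)).
    exact: (residual_coord_limit HU F x x0 B n HL B0 Hx Hx0 Hlim).
  exact: (seq_ulim_coord HU _ _ n Hy0).
have x0l2 : in_l2 x0 by apply/in_l2_iff; exists (B * B).
have y0l2 : in_l2 y0 by apply: (proj1 HK).
have Tail sg : sg = 1%Z \/ sg = (-1)%Z -> regular_end F sg -> forall e, 0 < e ->
    exists N0, forall N, (N0 <= N)%coq_nat -> U (fun k => forall L,
    @rsum L (fun j => nsq (seq_sub (x k) x0 (sg * Z.of_nat (N.+1 + j)%coq_nat)%Z)) <= e).
  move=> hsg [[g [Hg Hno]] [A [HA Hrem]]].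
  apply: (small_ray_energy HU F A sg x x0 (B * B)) => //; first by rewrite Ey.
  exact: (no_escaping_mass HU F g sg x y0 B hsg HL Hg Hno B0 Hx y0l2 Hy0).
have Hconv : seq_ulim (U := U) x x0.
  (* The central window and the two rays contribute at most [3 e], below [(r / 2)^2 = 4 e]. *)
  move=> r r0; set e := r * r / 16; have e0 : 0 < e by rewrite /e; nra.
  have [Np HNp] := Tail 1%Z (or_introl erefl) Hp e e0.
  have [Nm HNm] := Tail (-1)%Z (or_intror erefl) Hm e e0.
  set N := Nat.max Np Nm.
  have U1 := HNp N (Nat.le_max_l _ _); have U2 := HNm N (Nat.le_max_r _ _).
  have Hsub n : vulim (U := U) (fun k => seq_sub (x k) x0 n) (seq_sub x0 x0 n).
    exact: vulim_vsub.
  have := ulim_psum HU (fun k => seq_sub (x k) x0) (seq_sub x0 x0) N Hsub e e0.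
  have -> : psum (seq_sub x0 x0) N = 0.
    have Z n : nsq (seq_sub x0 x0 n) = 0.
      by rewrite (eq_nsq _ (vzero d)) ?nsq_zero // => i; rewrite /seq_sub /vsub /vzero; ring.
    by elim: N {U1 U2} => [|N IH]; rewrite ?psum0 ?psumS ?IH !Z; lra.
  move=> U3; apply: (ultra_mono HU _ _ (ultra_and HU _ _ U3 (ultra_and HU _ _ U1 U2))).
  move=> k [/Rabs_def2 [h3 _] [h1 h2]]; apply/dist_lt_iff; exists (r / 2).
  split; first lra; split; first lra.
  move=> M; apply: Rle_trans (psum_mono _ M (Nat.add N M) ltac:(lia)) _.
  rewrite psum_add; have := h1 M; have := h2 M.
  rewrite (eq_rsum _ (fun j : 'I_M => nsq (seq_sub (x k) x0 (- Z.of_nat (N.+1 + j)%coq_nat)%Z))); last first.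
    by move=> j; congr (nsq (seq_sub _ _ _)); lia.
  rewrite (eq_rsum (fun j : 'I_M => nsq (seq_sub (x k) x0 (1 * _)%Z)) (fun j : 'I_M => nsq (seq_sub (x k) x0 (Z.of_nat (N.+1 + j)%coq_nat)%Z))); last first.
    by move=> j; congr (nsq (seq_sub _ _ _)); lia.
  have : r / 2 * (r / 2) = e + e + e + e by rewrite /e; lra.
  lra.
exists x0; split => //; split; last by rewrite Ey.
apply: Ccl => // r r0.
by have [k hk] := ultra_ex HU _ (Hconv r r0); exists (x k); split; [exact: (proj1 (Dx k))|exact: dist_lt_sym].
Qed.

(** * Reduction of (A1), (A2), (A4) to regular ends *)

Theorem mainTheorem18 (d : nat)
  (f : Z -> R -> Rd d -> Rd d)
  (Dl : Z -> R -> Rd d -> Rd d) (Dx : Z -> R -> Rd d -> Mat d)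
  (HC1 : forall n, is_C1_S1 (f n) (Dl n) (Dx n))
  (Hf0 : forall n th, f n th (vzero d) = vzero d)
  (A1 : forall M eps, 0 < M -> 0 < eps -> exists del, 0 < del < M /\
     forall th1 th2 x1 x2, vnorm x1 <= M -> vnorm x2 <= M ->
       Rabs (th1 - th2) + vnorm (vsub x1 x2) < del ->
       sup_lt (fun n => mnorm (msub (Dx n th1 x1) (Dx n th2 x2))) eps /\
       sup_lt (fun n => vnorm (vsub (Dl n th1 x1) (Dl n th2 x2))) eps)
  (A2 : exists ap am : R -> Mat d,
     (forall eps, 0 < eps -> exists N : Z, forall n th, (N <= n)%Z ->
        mnorm (msub (Dx n th (vzero d)) (ap th)) < eps) /\
     (forall eps, 0 < eps -> exists N : Z, forall n th, (n <= - N)%Z ->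
        mnorm (msub (Dx n th (vzero d)) (am th)) < eps) /\
     (forall th, hyperbolic (ap th) /\ hyperbolic (am th) /\
        exists k, eig_count_disk (ap th) k /\ eig_count_disk (am th) k))
  (A4 : exists fp fm : R -> Rd d -> Rd d,
     (forall th M eps, 0 < eps -> exists N : Z, forall n x, (N <= n)%Z ->
        vnorm x <= M -> vnorm (vsub (f n th x) (fp th x)) < eps) /\
     (forall th M eps, 0 < eps -> exists N : Z, forall n x, (n <= - N)%Z ->
        vnorm x <= M -> vnorm (vsub (f n th x) (fm th x)) < eps) /\
     (forall th (x : Seq d), in_l2 x -> (forall n, x (n + 1)%Z = fp th (x n)) ->
        forall n, x n = vzero d) /\
     (forall th (x : Seq d), in_l2 x -> (forall n, x (n + 1)%Z = fm th (x n)) ->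
        forall n, x n = vzero d)) :
  forall th : R,
    (forall x : Seq d, in_l2 x -> in_l2 (Gmap f th x)) /\ proper_cb (Gmap f th).
Proof.
move=> th.
have [ap [am [Hap [Ham Hhyp]]]] := A2.
have [fp [fm [Hfp [Hfm [Nop Nom]]]]] := A4.
have [hyp_p [hyp_m _]] := Hhyp th.
pose F n := f n th; pose D n := Dx n th.
have HD : forall n, line_derivable (F n) (D n) by move=> n; exact: is_C1_line_derivable.
have Heq : uniformly_equicontinuous D.
  move=> M eps M0 eps0; have [del [[d0 _] H]] := A1 M eps M0 eps0.
  exists del; split => // n x y i j hx hy hxy.
  have := H th th x y (nsq_le_vnorm x M ltac:(lra) hx) (nsq_le_vnorm y M ltac:(lra) hy).
  rewrite Rminus_diag Rabs_R0 Rplus_0_l => /(_ hxy) [[eta [h1 h2]] _].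
  by apply: mnorm_lt_coord; apply: Rle_lt_trans h1; exact: h2.
have HL : uniformly_lipschitz_on_balls F.
  apply: (lipschitz_of_bounded_derivative F D HD).
  apply: (derivative_bounded D (ap th) (am th)) => //.
  - have [N H] := Hap 1 Rlt_0_1; exists N => n i j hn.
    by apply: mnorm_lt_coord; exact: H.
  - have [N H] := Ham 1 Rlt_0_1; exists (- N)%Z => n i j hn.
    by apply: mnorm_lt_coord; exact: H.
split; first by move=> x; exact: (residual_l2 F x HL (fun n => Hf0 n th)).
have sq_bound (g : R -> Rd d -> Rd d) (sg : Z) :
    (forall M eps, 0 < eps -> exists N : Z, forall n x, (N <= sg * n)%Z ->
        vnorm x <= M -> vnorm (vsub (F n x) (g th x)) < eps) ->
    forall M eps, 0 < eps -> exists N, forall n u, (N <= sg * n)%Z -> nsq u <= M * M ->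
       nsq (vsub (F n u) (g th u)) < eps.
  (* [Rabs M] is used because [nsq u <= M * M] makes sense for negative [M] as well. *)
  move=> H M eps eps0; have [N HN] := H (Rabs M) _ (sqrt_lt_R0 _ eps0).
  exists N => n u hn hu.
  rewrite -(sqrt_sqrt eps); last lra.
  apply: vnorm_lt_nsq; apply: HN => //; apply: nsq_le_vnorm; first exact: Rabs_pos.
  by rewrite -Rabs_mult Rabs_pos_eq //; exact: Rle_0_sqr.
apply: (residual_proper F) => //; split.
- exists (fp th); split; last exact: Nop.
  apply: sq_bound => M eps eps0; have [N HN] := Hfp th M eps eps0.
  by exists N => n u hn; apply: HN; lia.
- exists (ap th); split => //; apply: (linearization_remainder F D) => // eps eps0.
  have [N HN] := Hap eps eps0; exists N => n i j hn.
  by apply: mnorm_lt_coord; apply: HN; lia.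
- exists (fm th); split; last exact: Nom.
  apply: sq_bound => M eps eps0; have [N HN] := Hfm th M eps eps0.
  by exists N => n u hn; apply: HN; lia.
- exists (am th); split => //; apply: (linearization_remainder F D) => // eps eps0.
  have [N HN] := Ham eps eps0; exists N => n i j hn.
  by apply: mnorm_lt_coord; apply: HN; lia.
Qed.
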